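(* Given $q\in(1,\infty)$, $N>1$ and $\gamma,\eta>0$, there is $\varepsilon=\varepsilon(q,N,\gamma,\eta)>0$ such that the following holds: if $\nu\in\mathcal{P}(\mathbb{R})$ is an $(N,\gamma)$-uniformly perfect measure, then $$D(\mu\ast\nu,q)>D(\mu,q)+\varepsilon$$ for any measure $\mu\in\mathcal{P}(\mathbb{R})$ with $D(\mu,q)\le 1-\eta$.
   Context: $\mathcal{P}(\mathbb{R})$ denotes the family of compactly supported Borel probability measures on $\mathbb{R}$. Logarithms are to base $2$. For $m\in\mathbb{N}$, $\mathcal{D}_m=\{[k2^{-m},(k+1)2^{-m}):k\in\mathbb{Z}\}$. For $1<q<\infty$ and $\nu\in\mathcal{P}(\mathbb{R})$, the $L^q$ dimension of $\nu$ is $$D(\nu,q)=\liminf_{m\to\infty}\frac{-\log\sum_{Q\in\mathcal{D}_m}\nu(Q)^q}{(q-1)m}.$$ The convolution $\mu\ast\nu$ is the push-forward of $\mu\times\nu$ under $(x,y)\mapsto x+y$. $B(x,r)$ denotes the ball in $\mathbb{R}$ with centre $x$ and radius $r$, and $\operatorname{spt}\nu$ the support of $\nu$. For $N>1$ (not necessarily an integer) and $0<\gamma\le 1$, a measure $\nu\in\mathcal{P}(\mathbb{R})$ is $(N,\gamma)$-uniformly perfect if $\nu(B(x,Nr))\ge 2^{\gamma}\nu(B(x,r))$ for all $x\in\mathbb{R}$ and $r>0$ such that $\operatorname{spt}\nu\not\subset B(x,Nr)$.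
   Formalization: The measure ν is additionally assumed not to be a Dirac mass: every Dirac mass satisfies the stated definition of (N,γ)-uniformly perfect, and convolving with it only translates μ, so the claim as stated fails for it (e.g. μ = ν = δ_0, η ≤ 1). *)

(* Defs.v *)
From HB Require Import structures.
From mathcomp Require Import all_boot all_order all_algebra.
From mathcomp Require Import all_classical all_reals all_analysis measurable_realfun.

Set Implicit Arguments.
Unset Strict Implicit.
Unset Printing Implicit Defensive.

Import Order.TTheory GRing.Theory Num.Theory.
Import numFieldNormedType.Exports.

Local Open Scope classical_set_scope.
Local Open Scope ring_scope.

Notation borel_probability R := (probability (measurableTypeR R) R).

Definition spt (R : realType) (nu : borel_probability R) : set R :=
  [set x | forall r : R, 0 < r -> (0 < nu (ball x r))%E].

Definition compactly_supported (R : realType) (nu : borel_probability R) :=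
  compact (spt nu).

Definition dyadic (R : realType) (m : nat) : set (set R) :=
  [set Q | exists k : int,
     Q = `[k%:~R * 2 ^- m, (k + 1)%:~R * 2 ^- m[%classic].

Definition log2 (R : realType) (x : R) : R := ln x / ln 2.

(* The sum lies in ]0, +oo[ when nu is compactly supported, so that [fine]
   loses nothing; the junk value at m = 0 does not affect the liminf. *)
Definition Lq_dim (R : realType) (nu : borel_probability R) (q : R) : \bar R :=
  limn_einf (fun m : nat =>
    (- log2 (fine (\esum_(Q in @dyadic R m) (nu Q `^ q)%E)) /
       ((q - 1) * m%:R))%:E).

Definition add_pair (R : realType)
    (z : measurableTypeR R * measurableTypeR R) : measurableTypeR R :=
  (z.1 : R) + (z.2 : R).

Lemma measurable_add_pair (R : realType) :
  measurable_fun [set: measurableTypeR R * measurableTypeR R]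
    (@add_pair R).
Proof.
exact: (@measurable_funD _ _ R setT fst snd measurable_fst measurable_snd).
Qed.

HB.instance Definition _ (R : realType) :=
  isMeasurableFun.Build _ _ _ _ (@add_pair R) (@measurable_add_pair R).

(* [distribution] is the push-forward, bundled as a probability. *)
Definition convolution (R : realType) (mu nu : borel_probability R) :
    borel_probability R :=
  distribution (mu \x nu)%E (@add_pair R).

Definition uniformly_perfect (R : realType) (N gamma : R)
    (nu : borel_probability R) : Prop :=
  [/\ 1 < N, 0 < gamma <= 1 &
    forall x r : R, 0 < r -> ~ (spt nu `<=` ball x (N * r)) ->
      ((2 `^ gamma)%:E * nu (ball x r) <= nu (ball x (N * r)))%E].

(* Main.v *)
Require Import Defs.
From mathcomp Require Import all_boot all_order all_algebra.
From mathcomp Require Import all_classical all_reals all_analysis.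
From mathcomp Require Import complex.
From mathcomp Require Import zify ring lra.

Set Implicit Arguments.
Unset Strict Implicit.
Unset Printing Implicit Defensive.

Import Order.TTheory GRing.Theory Num.Theory.
Import numFieldNormedType.Exports.

Local Open Scope classical_set_scope.
Local Open Scope ring_scope.

(** Why convolution with a uniformly perfect measure raises the dimension.

    At scale [2 ^- m] the measures become finite laws [f] (for [mu]) and [nu] on
    a long cyclic group.  Write [T] for convolution by [nu].  The goal is a gain
    [2 ^- (kappa m)] in the q-th power sum, unless [f] is already spread almost
    evenly, that is, unless its power sum is already about [2 ^- ((q - 1) m)].
    At such scales nothing has to be gained, because [Lq_dim mu q <= 1 - eta].

    From one convolution to many.  [T] is a normal operator, so the energies
    [|T ^n 1_E| ^ 2] of the indicator of a set [E] are log-convex in [n], and a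
    loss that only becomes visible after [K] convolutions is shared by the first
    one ([energy_convolve_pow_le]).  After [K] convolutions the energy is at most
    [|E| ^ 2] times the largest atom of the [K]-fold convolution power of [nu].
    Hence everything follows once these atoms are at most [2 ^- ((1 - d) m)] up to
    a constant, for any prescribed [d > 0] and a suitable [K] depending on [d].
    Energies of indicators give back the q-th power sum of a general [f] by
    cutting [f] into its dyadic level sets ([convolve_Lq_le]): a level set that is
    too large for a gain carries little mass per point and is harmless.

    Spreading of convolution powers.  Group the scales in blocks of ratio [M].
    At each block scale, uniform perfectness produces a Markov kernel which
    preserves [nu], moves a point by an amount comparable to the scale with
    probability bounded below, and leaves it in place with probability at least
    one half ([metropolis_step_kernel]).  Running these kernels from the coarsest
    scale to the finest represents a sample of [nu] as a sum of displacements
    which are non-degenerate at every scale whatever happened before; no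
    exceptional points have to be discarded.

    For [K] independent samples, at each scale the sum of the [K] displacements
    is spread over a window of width about [sqrt K] times the scale, whereas what
    the finer scales add has size about [sqrt K / M] times the scale.  So each
    scale divides the probability of hitting a given target by about [M], up to
    the factor [M `^ d] ([one_step_decay]); the weight [exp (- |u|)], with [u] the
    distance to the target in units of the current window, carries this estimate
    from scale to scale ([hit_le]).  The input at a single scale is a
    concentration inequality, obtained by testing against a Fejer kernel
    ([concentration]), and a sub-Gaussian tail ([mgf_sum_le]).

    Passing to the limit, the power sums satisfy
    [S (mu * nu) <= C (m + 1) ^ (q + 1) (2 ^- (kappa m) S mu +
    2 ^- ((q - 1) (1 - 2 d) m))] with [kappa] depending only on [q], [N], [gamma]
    and [d] ([dyadic_sum_improvement]), and the lower limits compare as claimed. *)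

(** * Elementary bounds for the exponential and the cosine *)

Lemma expR_le_quadratic (R : realType) (x : R) :
  `|x| <= 1 / 2 -> expR x <= 1 + x + 2 * x ^+ 2.
Proof.
rewrite ler_norml => /andP[xl xu].
have pos : 0 < 1 - x by lra.
have h : expR x <= (1 - x)^-1.
  rewrite -[expR x]invrK lef_pV2 ?posrE ?invr_gt0 ?expR_gt0 //.
  by rewrite -expRN; exact: expR_ge1Dx.
apply: (le_trans h); rewrite -[_^-1]mul1r ler_pdivrMr //.
have : 0 <= x ^+ 2 * (1 - 2 * x) by apply: mulr_ge0; [exact: sqr_ge0|lra].
nra.
Qed.

Lemma sin_mean_value (R : realType) (y : R) : 0 < y ->
  exists2 c, 0 < c < y & sin y = cos c * y.
Proof.
move=> y0.
have dsin (t : R) : t \in `]0, y[ -> is_derive t 1 (@sin R) (cos t).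
  by move=> _; exact: is_derive_sin.
have csin : {within `[0, y], continuous (@sin R)}.
  by apply: continuous_subspaceT => z; exact: continuous_sin.
have [c] := MVT y0 dsin csin.
by rewrite in_itv /= sin0 !subr0 => c0y ->; exists c.
Qed.

Lemma norm_sin_le (R : realType) (x : R) : `|sin x| <= `|x|.
Proof.
have key (y : R) : 0 < y -> `|sin y| <= y.
  move=> y0; have [c _ ->] := sin_mean_value y0.
  rewrite normrM (gtr0_norm y0) -[leRHS]mul1r.
  by rewrite ler_wpM2r ?(ltW y0) // cos_max.
have [x0|x0|<-] := ltgtP 0 x; last by rewrite sin0 normr0.
- by rewrite (gtr0_norm x0) key.
- by rewrite (ltr0_norm x0) -normrN -sinN key // oppr_gt0.
Qed.

Lemma cos_half (R : realType) (x : R) : cos x = 1 - 2 * sin (x / 2) ^+ 2.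
Proof.
have {1}-> : x = (x / 2) *+ 2 by rewrite mulr2n -splitr.
by rewrite cos_mulr2n cos2sin2 mulr2n; ring.
Qed.

Lemma cos_ge_quadratic (R : realType) (x : R) : 1 - x ^+ 2 / 2 <= cos x.
Proof.
rewrite cos_half; have := norm_sin_le (x / 2).
rewrite -(@ler_pXn2r _ 2) ?nnegrE ?normr_ge0 // !real_normK ?num_real // => h.
have : (x / 2) ^+ 2 = x ^+ 2 / 4 by field.
by lra.
Qed.

Lemma cos_le_quadratic (R : realType) (x : R) :
  `|x| <= 1 -> cos x <= 1 - x ^+ 2 / 4.
Proof.
have key (y : R) : 0 < y <= 1 / 2 -> 7 / 8 * y <= sin y.
  move=> /andP[y0 y1]; have [c /andP[c0 cy] ->] := sin_mean_value y0.
  rewrite ler_wpM2r ?(ltW y0) //; apply: le_trans (cos_ge_quadratic _).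
  by nra.
have pos (y : R) : 0 < y -> y <= 1 -> cos y <= 1 - y ^+ 2 / 4.
  move=> y0 y1; rewrite cos_half.
  have : 7 / 8 * (y / 2) <= sin (y / 2) by apply: key; lra.
  by nra.
have [x0|x0|<-] := ltgtP 0 x.
- by rewrite gtr0_norm //; exact: pos.
- by rewrite ltr0_norm // => h; rewrite -cosN -sqrrN pos // oppr_gt0.
- by rewrite cos0 expr0n mul0r subr0.
Qed.

(** * Independent variables with finitely many values *)

Section IndependentVariables.
Variables (R : realType) (T : finType) (k : nat).
Implicit Types (p v : 'I_k -> T -> R) (x : {ffun 'I_k -> T}).

Definition prod_law p x : R := \prod_i p i (x i).

Definition expect p (F : {ffun 'I_k -> T} -> R) : R :=
  \sum_x prod_law p x * F x.

Definition laws p := forall i, (forall t, 0 <= p i t) /\ \sum_t p i t = 1.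

Lemma prod_law_ge0 p x : laws p -> 0 <= prod_law p x.
Proof. by move=> pP; apply: prodr_ge0 => i _; have [] := pP i. Qed.

Lemma expect_prod p (F : 'I_k -> T -> R) :
  expect p (fun x => \prod_i F i (x i)) = \prod_i \sum_t p i t * F i t.
Proof.
by rewrite bigA_distr_bigA; apply: eq_bigr => x _; rewrite -big_split.
Qed.

Lemma expect1 p : laws p -> expect p (fun=> 1) = 1.
Proof.
move=> pP; have := expect_prod p (fun _ _ => 1).
have -> : \prod_i \sum_t p i t * 1 = 1.
  apply: big1 => i _; rewrite -[RHS](proj2 (pP i)).
  by apply: eq_bigr => t _; rewrite mulr1.
move=> h; rewrite -[RHS]h /expect.
by under [RHS]eq_bigr do rewrite big1_eq.
Qed.

Lemma le_expect p F G : laws p ->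
  (forall x, 0 < prod_law p x -> F x <= G x) -> expect p F <= expect p G.
Proof.
move=> pP FG; apply: ler_sum => x _.
have := prod_law_ge0 x pP; rewrite le_eqVlt => /predU1P[<-|x0].
  by rewrite !mul0r.
by rewrite ler_wpM2l ?(ltW x0) ?FG.
Qed.

Lemma expectD p F G : expect p (fun x => F x + G x) = expect p F + expect p G.
Proof.
by rewrite /expect -big_split; apply: eq_bigr => x _; rewrite mulrDr.
Qed.

Lemma expectZ p c F : expect p (fun x => c * F x) = c * expect p F.
Proof. by rewrite /expect mulr_sumr; apply: eq_bigr => x _; rewrite mulrCA. Qed.

Lemma expect_sum p (I : Type) (r : seq I) (P : pred I) (F : I -> _ -> R) :
  expect p (fun x => \sum_(i <- r | P i) F i x) =
  \sum_(i <- r | P i) expect p (F i).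
Proof.
rewrite /expect exchange_big; apply: eq_bigr => x _; exact: mulr_sumr.
Qed.

(** Sub-Gaussian bound: each factor obeys the quadratic bound for the
    exponential, whose linear term averages to zero. *)
Lemma mgf_sum_le p v (B s : R) : laws p ->
  (forall i t, 0 < p i t -> `|v i t| <= B) ->
  (forall i, \sum_t p i t * v i t = 0) -> `|s| * B <= 1 / 2 ->
  expect p (fun x => expR (s * \sum_i v i (x i))) <=
    expR (2 * k%:R * (s * B) ^+ 2).
Proof.
move=> pP vB v0 sB.
have -> : expect p (fun x => expR (s * \sum_i v i (x i))) =
    expect p (fun x => \prod_i expR (s * v i (x i))).
  by apply: eq_bigr => x _; rewrite mulr_sumr expR_sum.
rewrite (expect_prod p (fun i t => expR (s * v i t))).
have -> : expR (2 * k%:R * (s * B) ^+ 2) =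
    \prod_(i < k) expR (2 * (s * B) ^+ 2).
  by rewrite prodr_const card_ord -expRM_natr; congr expR; ring.
apply: ler_prod => i _; have [p0 p1] := pP i.
rewrite sumr_ge0 => [|t _]; last by rewrite mulr_ge0 ?expR_ge0.
apply: (@le_trans _ _ (1 + 2 * (s * B) ^+ 2)); last exact: expR_ge1Dx.
apply: (@le_trans _ _ (\sum_t (p i t + s * (p i t * v i t) +
    p i t * (2 * (s * B) ^+ 2)))); last first.
  rewrite !big_split /= -[\sum_i s * _]mulr_sumr v0 mulr0 addr0.
  by rewrite -mulr_suml p1 mul1r.
apply: ler_sum => t _; have := p0 t; rewrite le_eqVlt => /predU1P[<-|pt0].
  by rewrite !mul0r mulr0 !addr0.
have {}vB := vB i t pt0.
have sv : `|s * v i t| <= `|s| * B by rewrite normrM ler_wpM2l.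
have := expR_le_quadratic (le_trans sv sB).
have : (s * v i t) ^+ 2 <= (s * B) ^+ 2.
  rewrite -real_normK ?num_real // -(@real_normK _ (s * B)) ?num_real //.
  rewrite ler_pXn2r ?nnegrE //; apply: (le_trans sv); rewrite normrM.
  by rewrite ler_wpM2l // ler_norm.
move: pt0; set q := p i t; set w := v i t; set e := expR _.
move=> q0 h1 h2.
have : q * e <= q * (1 + s * w + 2 * (s * B) ^+ 2).
  by rewrite ler_wpM2l ?(ltW q0) //; lra.
by lra.
Qed.

End IndependentVariables.
Arguments expect {R T k}.
Arguments laws {R T k}.
Arguments prod_law {R T k}.

(** * Characteristic functions *)

Section CharacteristicFunction.
Local Open Scope complex_scope.
Local Open Scope ring_scope.
Variable R : realType.

Definition cis (t : R) : R[i] := (cos t +i* sin t)%C.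

Lemma cisD s t : cis (s + t) = cis s * cis t.
Proof.
apply/eqP; rewrite eq_complex /= cosD sinD eqxx.
by rewrite mulrC (mulrC _ (sin t)) addrC /=.
Qed.

Lemma cis0 : cis 0 = 1.
Proof. by rewrite /cis cos0 sin0. Qed.

Lemma cis_sum (I : Type) (r : seq I) (P : pred I) (F : I -> R) :
  cis (\sum_(i <- r | P i) F i) = \prod_(i <- r | P i) cis (F i).
Proof. exact: (big_morph cis cisD cis0). Qed.

Lemma normc_cis t : Normc.normc (cis t) = 1.
Proof. by rewrite /Normc.normc /= cos2Dsin2 sqrtr1. Qed.

Lemma normc_real_ge0 (a : R) : 0 <= a -> Normc.normc a%:C = a.
Proof. by move=> a0; rewrite /Normc.normc /= expr0n addr0 sqrtr_sqr ger0_norm. Qed.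

Lemma normc_1cis t : `|t| <= 2 -> Normc.normc (1 + cis t) = 2 * cos (t / 2).
Proof.
move=> t2; have c0 : 0 <= 2 * cos (t / 2).
  rewrite mulr_ge0 //; apply: le_trans (cos_ge_quadratic _).
  have : (t / 2) ^+ 2 <= 1.
    rewrite -(@real_normK _ (t / 2)) ?num_real // expr_le1 // normrM.
    by rewrite (@ger0_norm _ (2^-1)) ?ler_pdivrMr ?mul1r // invr_ge0.
  by lra.
rewrite /Normc.normc /= -[RHS]ger0_norm // -sqrtr_sqr; congr Num.sqrt.
have -> : cos t = 2 * cos (t / 2) ^+ 2 - 1.
  have {1}-> : t = (t / 2) *+ 2 by rewrite mulr2n -splitr.
  by rewrite cos_mulr2n; ring.
have -> : sin t = 2 * cos (t / 2) * sin (t / 2).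
  have {1}-> : t = (t / 2) *+ 2 by rewrite mulr2n -splitr.
  by rewrite sin_mulr2n; ring.
have := sin2cos2 (t / 2); set s := sin _; set c := cos _ => h.
by rewrite add0r exprMn h; ring.
Qed.

Lemma Re_sum (I : Type) (r : seq I) (P : pred I) (F : I -> R[i]) :
  complex.Re (\sum_(i <- r | P i) F i) = \sum_(i <- r | P i) complex.Re (F i).
Proof. by apply: (big_morph (@complex.Re R)) => // -[a b] [c d]. Qed.

Lemma Re_le_normc (z : R[i]) : complex.Re z <= Normc.normc z.
Proof.
case: z => a b /=; apply: (le_trans (ler_norm a)).
by rewrite -sqrtr_sqr ler_wsqrtr // lerDl sqr_ge0.
Qed.

Lemma ler_normc_sum (I : Type) (r : seq I) (P : pred I) (F : I -> R[i]) :
  Normc.normc (\sum_(i <- r | P i) F i) <=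
  \sum_(i <- r | P i) Normc.normc (F i).
Proof.
elim/big_ind2 : _ => [|z a w b za wb|//]; first by rewrite Normc.normc0.
by apply: le_trans (le_normcD _ _) _; exact: lerD.
Qed.

(** A law with an atom of mass at least one half has no cancellation to hide
    behind: pairing the remaining mass with the atom, each pair [1 + cis w] is
    shorter than 2 by an amount of order [w ^+ 2]. *)
Lemma normc_char_le (T : finType) (p w : T -> R) (t0 : T) (a c : R) :
  (forall t, 0 <= p t) -> \sum_t p t = 1 -> w t0 = 0 -> 1 / 2 <= p t0 ->
  (forall t, 0 < p t -> `|w t| <= 2) -> 0 <= a ->
  c <= \sum_(t | a <= `|w t|) p t ->
  Normc.normc (\sum_t (p t)%:C * cis (w t)) <= 1 - c * a ^+ 2 / 8.
Proof.
move=> p0 p1 w0 pt0 w2 a0 hc.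
have cosb t : 0 < p t -> 2 * cos (w t / 2) <= 2 - (w t) ^+ 2 / 8.
  move=> pt; have : `|w t / 2| <= 1.
    by rewrite normrM (@ger0_norm _ (2^-1)) ?ler_pdivrMr ?mul1r ?w2 // invr_ge0.
  move/cos_le_quadratic; have -> : (w t / 2) ^+ 2 = (w t) ^+ 2 / 4 by field.
  by lra.
have -> : \sum_t (p t)%:C * cis (w t) =
    \sum_(t | t != t0) (p t)%:C * (1 + cis (w t)) + (2 * p t0 - 1)%:C.
  rewrite (bigD1 t0) //= w0 cis0 mulr1 addrC.
  under [in RHS]eq_bigr => t _ do rewrite mulrDr mulr1.
  rewrite big_split /= -addrA addrCA; congr (_ + _).
  rewrite -rmorph_sum /= -rmorphD /=; congr (_%:C).
  have : p t0 + \sum_(t | t != t0) p t = 1 by rewrite -p1 [RHS](bigD1 t0).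
  by lra.
apply: (le_trans (le_normcD _ _)).
rewrite (normc_real_ge0 (a := 2 * p t0 - 1)); last by lra.
have {}cosb t : Normc.normc ((p t)%:C * (1 + cis (w t))) <=
    2 * p t - p t * (w t ^+ 2 / 8).
  rewrite Normc.normcM normc_real_ge0 //.
  have := p0 t; rewrite le_eqVlt => /predU1P[<-|pt]; first by rewrite !mul0r mulr0 subr0.
  rewrite (normc_1cis (w2 _ pt)).
  have : p t * (2 * cos (w t / 2)) <= p t * (2 - w t ^+ 2 / 8).
    by rewrite ler_wpM2l ?cosb // ltW.
  by lra.
have {}hc : c * (a ^+ 2 / 8) <= \sum_t p t * (w t ^+ 2 / 8).
  apply: (@le_trans _ _ (\sum_(t | a <= `|w t|) p t * (a ^+ 2 / 8))).
    by rewrite -mulr_suml ler_wpM2r // divr_ge0 ?sqr_ge0.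
  rewrite [leRHS](bigID (fun t => a <= `|w t|)) /=.
  apply: ler_wpDr.
    by apply: sumr_ge0 => t _; rewrite mulr_ge0 // divr_ge0 ?sqr_ge0.
  apply: ler_sum => t at_; rewrite ler_wpM2l // ler_wpM2r ?invr_ge0 //.
  by rewrite -[leRHS]real_normK ?num_real // ler_pXn2r ?nnegrE.
apply: (@le_trans _ _ (\sum_(t | t != t0)
    (2 * p t - p t * (w t ^+ 2 / 8)) + (2 * p t0 - 1))).
  rewrite lerD2r; apply: (le_trans (ler_normc_sum _ _ _)).
  by apply: ler_sum => t _; exact: cosb.
rewrite big_split /= sumrN -mulr_sumr.
have : p t0 + \sum_(t | t != t0) p t = 1 by rewrite -p1 [RHS](bigD1 t0).
have : \sum_t p t * (w t ^+ 2 / 8) = \sum_(t | t != t0) p t * (w t ^+ 2 / 8).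
  by rewrite (bigD1 t0) //= w0 expr0n mul0r mulr0 add0r.
by lra.
Qed.

(** The characteristic function of a sum of independent variables is the product
    of theirs; the cosine is its real part after a rotation by [- s * u]. *)
Lemma expect_cos_le (T : finType) (k : nat) (p v : 'I_k -> T -> R) (s u : R) :
  expect p (fun x => cos (s * (\sum_i v i (x i) - u))) <=
  \prod_i Normc.normc (\sum_t (p i t)%:C * cis (s * v i t)).
Proof.
have -> : expect p (fun x => cos (s * (\sum_i v i (x i) - u))) =
  complex.Re (cis (- (s * u)) * \prod_i (\sum_t (p i t)%:C * cis (s * v i t))).
  rewrite bigA_distr_bigA mulr_sumr Re_sum; apply: eq_bigr => x _.
  rewrite big_split /= -rmorph_prod /= -cis_sum mulrCA -cisD.
  by rewrite /= mul0r subr0 -mulr_sumr mulrBr addrC.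
apply: (le_trans (Re_le_normc _)); rewrite Normc.normcM normc_cis mul1r.
by rewrite (big_morph _ (@Normc.normcM R) (Normc.normc1 R)).
Qed.

End CharacteristicFunction.

(** * Concentration of sums by Fejer kernels *)

Section Concentration.
Variable R : realType.

(** The double sum is a squared modulus, which makes the Fejer kernel
    nonnegative everywhere. *)
Lemma sum_cos_cos (n : nat) (t : R) :
  \sum_(j < n) \sum_(l < n) cos ((j%:R - l%:R) * t) =
  (\sum_(j < n) cos (j%:R * t)) ^+ 2 + (\sum_(j < n) sin (j%:R * t)) ^+ 2.
Proof.
rewrite !expr2 !mulr_suml -big_split; apply: eq_bigr => j _ /=.
rewrite !mulr_sumr -big_split; apply: eq_bigr => l _ /=.
by rewrite mulrBl cosB.
Qed.

Lemma fejer_ge (n : nat) (t : R) : (0 < n)%N -> `|t| <= n%:R^-1 ->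
  1 <= 4 / n%:R ^+ 2 * \sum_(j < n) \sum_(l < n) cos ((j%:R - l%:R) * t).
Proof.
move=> n0 tn; have nR : 0 < n%:R :> R by rewrite ltr0n.
have c2 : n%:R / 2 <= \sum_(j < n) cos (j%:R * t).
  rewrite -[leLHS]mulr1 mulrAC -mulrA -[n in leLHS]card_ord -sum1_card.
  rewrite natr_sum mulr_suml; apply: ler_sum => j _; rewrite mul1r.
  apply: le_trans (cos_ge_quadratic _).
  have : (j%:R * t) ^+ 2 <= 1.
    rewrite -(@real_normK _ (_ * _)) ?num_real // expr_le1 // normrM normr_nat.
    apply: (@le_trans _ _ (n%:R * n%:R^-1)); last by rewrite mulfV // gt_eqF.
    by rewrite ler_pM // ler_nat ltnW.
  by lra.
rewrite sum_cos_cos -[leLHS](@mulVf _ (n%:R ^+ 2 / 4)); last first.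
  by rewrite mulf_neq0 ?invr_neq0 // ?expf_neq0 // gt_eqF.
rewrite invf_div ler_wpM2l ?divr_ge0 ?sqr_ge0 // ler_wpDr ?sqr_ge0 //.
have -> : n%:R ^+ 2 / 4 = (n%:R / 2) ^+ 2 :> R by field.
by rewrite ler_pXn2r ?nnegrE ?divr_ge0 ?(le_trans _ c2) ?divr_ge0.
Qed.

Lemma sum_geometric_le (q : R) (n : nat) : 0 <= q < 1 ->
  \sum_(i < n) q ^+ i <= (1 - q)^-1.
Proof.
move=> /andP[q0 q1]; have d : 0 < 1 - q by rewrite subr_gt0.
rewrite -[leRHS]mul1r ler_pdivlMr //.
have -> : (\sum_(i < n) q ^+ i) * (1 - q) = 1 - q ^+ n.
  elim: n => [|n IH]; first by rewrite big_ord0 mul0r expr0 subrr.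
  by rewrite big_ord_recr /= mulrDl IH exprS; ring.
by rewrite gerBl exprn_ge0.
Qed.

(** Subtraction being truncated, [(j - l) + (l - j)] is the distance of [j] and
    [l]. *)
Lemma sum_toeplitz_le (q : R) (n : nat) : 0 <= q < 1 ->
  \sum_(j < n) \sum_(l < n) q ^+ ((j - l) + (l - j)) <= n%:R * (2 / (1 - q)).
Proof.
move=> q01; have /andP[q0 q1] := q01.
have half : \sum_(j < n) \sum_(l < n | (l <= j)%N) q ^+ (j - l) <=
    n%:R * (1 - q)^-1.
  rewrite mulr_natl -[X in _ *+ X]card_ord -sumr_const; apply: ler_sum => j _.
  rewrite -(@big_ord_widen_cond _ _ _ j.+1 n xpredT (fun l => q ^+ (j - l))) //.
  rewrite (reindex_inj rev_ord_inj) /=.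
  under eq_bigr => i _ do rewrite subSS subKn -1?ltnS //.
  exact: sum_geometric_le.
have -> : n%:R * (2 / (1 - q)) = n%:R * (1 - q)^-1 + n%:R * (1 - q)^-1 by ring.
apply: le_trans (lerD half half); rewrite [X in _ <= _ + X](exchange_big_dep xpredT) //=.
rewrite -big_split /=; apply: ler_sum => j _.
rewrite [X in X + _]big_mkcond [X in _ + X]big_mkcond -big_split /=.
apply: ler_sum => l _; case: (leqP l j) => [lj|/ltnW jl].
  have /eqP -> : (l - j == 0)%N by rewrite subn_eq0.
    rewrite addn0 lerDl.
  by case: ifP => // _; exact: exprn_ge0.
have /eqP -> : (j - l == 0)%N by rewrite subn_eq0.
  by rewrite add0n jl add0r.
Qed.

(** Testing the law of the sum against a Fejer kernel of order [n] turns
    decay of its characteristic function at the first [n] harmonics into a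
    bound of order [1 / n] for the mass of a window of width [1 / n]. *)
Lemma concentration (T : finType) (k : nat) (p v : 'I_k -> T -> R)
    (s u q : R) (n : nat) :
  laws p -> (0 < n)%N -> 0 <= q < 1 ->
  (forall j, (j < n)%N ->
    \prod_i Normc.normc (\sum_t (p i t)%:C%C * cis (j%:R * s * v i t)) <= q ^+ j) ->
  expect p (fun x => (`|s * (\sum_i v i (x i) - u)| <= n%:R^-1)%R%:R) <=
    8 / (n%:R * (1 - q)).
Proof.
move=> pP n0 q01 hq.
pose D (x : {ffun 'I_k -> T}) : R := s * (\sum_i v i (x i) - u).
have nR : 0 < n%:R :> R by rewrite ltr0n.
have c0 : 0 <= 4 / n%:R ^+ 2 :> R by rewrite divr_ge0 ?sqr_ge0.
apply: (@le_trans _ _ (expect p (fun x =>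
    4 / n%:R ^+ 2 * \sum_(j < n) \sum_(l < n) cos ((j%:R - l%:R) * D x)))).
  apply: le_expect => // x _; case: (leP `|_| _) => h; first exact: fejer_ge.
  by rewrite mulr_ge0 // sum_cos_cos addr_ge0 ?sqr_ge0.
rewrite expectZ; apply: (@le_trans _ _ (4 / n%:R ^+ 2 * (n%:R * (2 / (1 - q))))).
  rewrite ler_wpM2l //; apply: le_trans (sum_toeplitz_le n q01).
  rewrite expect_sum; apply: ler_sum => j _.
  rewrite expect_sum; apply: ler_sum => l _.
  set d := ((j - l) + (l - j))%N.
  have dn : (d < n)%N by rewrite /d; have := ltn_ord j; have := ltn_ord l; lia.
  apply: le_trans (hq d dn).
  apply: le_trans (expect_cos_le _ _ (d%:R * s) u).
  apply: ler_sum => x _; rewrite ler_wpM2l ?prod_law_ge0 //.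
  rewrite -mulrA -/(D x) /d; case: (leqP l j) => [lj|/ltnW jl].
    have /eqP -> : (l - j == 0)%N by rewrite subn_eq0.
    by rewrite addn0 natrB.
  have /eqP -> : (j - l == 0)%N by rewrite subn_eq0.
  rewrite add0n natrB //.
  by rewrite -(opprB l%:R) mulNr cosN.
have /andP[_ q1] := q01.
rewrite le_eqVlt; apply/orP; left; apply/eqP; field.
by rewrite !gt_eqF // subr_gt0.
Qed.

End Concentration.

(** * The gain at a single scale *)

Section OneStep.
Variables (R : realType) (T : finType) (k : nat).
Variables (p v : 'I_k -> T -> R) (t0 : 'I_k -> T) (B c : R).
Hypotheses (k0 : (0 < k)%N) (B0 : 0 < B) (c0 : 0 < c).
Hypotheses (pP : laws p) (vB : forall i t, 0 < p i t -> `|v i t| <= B).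
Hypothesis v0 : forall i, \sum_t p i t * v i t = 0.
Hypothesis stay : forall i, 1 / 2 <= p i (t0 i).
Hypothesis moves : forall i,
  c <= \sum_(t | 1 / 2 <= `|v i t - v i (t0 i)|) p i t.

Definition normalized_sum (x : {ffun 'I_k -> T}) : R :=
  (\sum_i v i (x i)) / Num.sqrt k%:R.

(** Each of the [k] variables loses [c * j ^ 2 / (32 * k)] at the frequency
    [j / sqrt k], all of them together [c * j ^ 2 / 32], and [j <= j ^ 2]: the
    characteristic function of the normalized sum decays geometrically in [j]. *)
Definition char_rate : R := expR (- (c / 32)).

Lemma char_rate01 : 0 <= char_rate < 1.
Proof. by rewrite /char_rate expR_ge0 expR_lt1 oppr_lt0 divr_gt0. Qed.

Lemma char_product_le (j : nat) : j%:R * B <= Num.sqrt k%:R ->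
  \prod_i Normc.normc
    (\sum_t (p i t)%:C%C * cis (j%:R * (Num.sqrt k%:R)^-1 * v i t)) <=
  char_rate ^+ j.
Proof.
move=> jB; set s := _^-1.
have s0 : 0 < s by rewrite invr_gt0 sqrtr_gt0 ltr0n.
have js0 : 0 <= j%:R * s by rewrite mulr_ge0 // ltW.
have ss : s ^+ 2 = k%:R^-1 by rewrite exprVn sqr_sqrtr.
have one i : Normc.normc (\sum_t (p i t)%:C%C * cis (j%:R * s * v i t)) <=
    expR (- (c / 32 * j%:R ^+ 2 / k%:R)).
  have [p0 p1] := pP i.
  have pt0 : 0 < p i (t0 i) by apply: lt_le_trans (stay i); rewrite divr_gt0.
  have -> : \sum_t (p i t)%:C%C * cis (j%:R * s * v i t) =
    cis (j%:R * s * v i (t0 i)) *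
      \sum_t (p i t)%:C%C * cis (j%:R * s * (v i t - v i (t0 i))).
    rewrite mulr_sumr; apply: eq_bigr => t _.
    by rewrite mulrCA -cisD -mulrDr addrC subrK.
  rewrite Normc.normcM normc_cis mul1r.
  apply: (@le_trans _ _ (1 - c * (j%:R * s / 2) ^+ 2 / 8)).
    apply: (@normc_char_le _ _ _ _ (t0 i)) => //.
    - by rewrite subrr mulr0.
    - move=> t pt; rewrite normrM ger0_norm //.
      apply: (@le_trans _ _ (j%:R * s * (B + B))).
        by rewrite ler_wpM2l // (le_trans (ler_normB _ _)) // lerD ?vB.
      have : j%:R * s * B <= 1.
        by rewrite mulrAC -ler_pdivlMr // div1r invrK.
      by lra.
    - by rewrite divr_ge0.
    - apply: (le_trans (moves i)).
      rewrite big_mkcond [leRHS]big_mkcond; apply: ler_sum => t _.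
      case: ifP => h1; last by case: ifP.
      rewrite ifT // normrM ger0_norm // ler_wpM2l //.
      by rewrite -[_^-1]mul1r.
  apply: le_trans (expR_ge1Dx _); rewrite lerD2l lerN2 !exprMn ss.
  by rewrite le_eqVlt; apply/orP; left; apply/eqP; field; rewrite pnatr_eq0 -lt0n.
apply: (@le_trans _ _ (\prod_(i < k) expR (- (c / 32 * j%:R ^+ 2 / k%:R)))).
  by apply: ler_prod => i _; rewrite one andbT;
    case: (\sum_t _) => a b /=; rewrite sqrtr_ge0.
rewrite prodr_const card_ord -!expRM_natr ler_expR.
rewrite !mulNr lerN2 divfK ?pnatr_eq0 -?lt0n // ler_wpM2l ?divr_ge0 ?(ltW c0) //.
rewrite -natrX ler_nat expnS expn1; nia.
Qed.

Lemma normalized_concentration (n : nat) (u : R) :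
  (0 < n)%N -> n%:R * B <= Num.sqrt k%:R ->
  expect p (fun x => (`|u - normalized_sum x| <= n%:R^-1)%R%:R) <=
    8 / (n%:R * (1 - char_rate)).
Proof.
move=> n0 nB; pose s : R := Num.sqrt k%:R.
have s0 : 0 < s by rewrite sqrtr_gt0 ltr0n.
have h := @concentration R T k p v s^-1 (u * s) char_rate n pP n0 char_rate01.
apply: le_trans (h _) => [|j jn]; last first.
  apply: char_product_le; apply: le_trans nB.
  by rewrite ler_wpM2r ?(ltW B0) // ler_nat ltnW.
apply: le_expect => // x _; rewrite ler_nat.
suff -> : `|u - normalized_sum x| = `|s^-1 * (\sum_i v i (x i) - u * s)| by [].
by rewrite distrC mulrBr mulrC (mulrC u) mulKf // gt_eqF.
Qed.

Lemma normalized_mgf_le (t : R) : 0 <= t -> t * B <= Num.sqrt k%:R / 2 ->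
  expect p (fun x => expR (t * `|normalized_sum x|)) <=
    2 * expR (2 * (t * B) ^+ 2).
Proof.
move=> t_ge0 tB; set s : R := Num.sqrt k%:R in tB.
have s0 : 0 < s by rewrite sqrtr_gt0 ltr0n.
have ss : s ^+ 2 = k%:R by rewrite sqr_sqrtr.
have bound (e : R) : `|e| = t / s ->
  expect p (fun x => expR (e * \sum_i v i (x i))) <= expR (2 * (t * B) ^+ 2).
  move=> es; apply: (@le_trans _ _ (expR (2 * k%:R * (e * B) ^+ 2))).
    apply: mgf_sum_le => //; rewrite es mulrAC ler_pdivrMr //; lra.
  have e2 : e ^+ 2 = (t / s) ^+ 2 by rewrite -es real_normK ?num_real.
  rewrite ler_expR !exprMn e2 expr_div_n ss le_eqVlt; apply/orP; left.
  by apply/eqP; field; rewrite pnatr_eq0 -lt0n.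
have ts : `|t / s| = t / s by rewrite ger0_norm // divr_ge0 // ltW.
have := lerD (bound (t / s) ts) (bound (- (t / s)) (etrans (normrN _) ts)).
have <- : 2 * expR (2 * (t * B) ^+ 2) =
  expR (2 * (t * B) ^+ 2) + expR (2 * (t * B) ^+ 2) by ring.
rewrite -expectD; apply: le_trans.
apply: le_expect => // x _; rewrite /normalized_sum -/s.
set S := \sum_i _; rewrite mulNr -mulrN.
have -> : t / s * S = t * (S / s) by ring.
have -> : t / s * - S = t * - (S / s) by ring.
by case: (ger0P (S / s)) => _; [rewrite lerDl|rewrite lerDr]; exact: expR_ge0.
Qed.

End OneStep.

Section OneStepDecay.
Variable R : realType.

Lemma expR_ge_affine_sq (x : R) : 0 <= x -> (1 + x / 2) ^+ 2 <= expR x.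
Proof.
move=> x0; have -> : expR x = expR (x / 2) ^+ 2.
  by rewrite -expRM_natr; congr expR; field.
by rewrite ler_pXn2r ?nnegrE ?expR_ge0 ?expR_ge1Dx // addr_ge0 ?divr_ge0.
Qed.

Lemma affine_le_expR (C d : R) : 0 <= C -> 0 < d ->
  exists2 L0 : R, 1 <= L0 &
    forall L, L0 <= L -> C * (1 + L) <= expR (d * L).
Proof.
move=> C0 d0; exists (1 + 8 * C / d ^+ 2).
  by rewrite lerDl divr_ge0 ?sqr_ge0 ?mulr_ge0.
move=> L hL; have d2 : 0 < d ^+ 2 by rewrite exprn_gt0.
have CL : 8 * C <= d ^+ 2 * L.
  by rewrite [leRHS]mulrC -ler_pdivrMr //; apply: le_trans hL; rewrite lerDr.
have L1 : 1 <= L.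
  by apply: le_trans hL; rewrite lerDl divr_ge0 ?mulr_ge0 // ltW.
apply: le_trans (expR_ge_affine_sq _); last first.
  by rewrite mulr_ge0 ?ltW // (lt_le_trans _ L1).
have : 8 * C * L <= d ^+ 2 * L * L by rewrite ler_wpM2r //; lra.
nra.
Qed.

(** Where a single scale is won.  The mean of [expR (- (M * |u - Y|))] is split
    between a window around [u] of width about [ln M / M], whose probability is of
    that order by concentration, and its complement, where the weight is at most
    [1 / M] times [expR (- |u - Y|)].  Replacing [expR (- |u - Y|)] by
    [expR (- |u|)] costs [expR |Y|], which the moment generating function
    controls, up to the factor [M `^ (d / 2)] on the window. *)
Lemma one_step_decay (B c d : R) : 0 < B -> 0 < c -> 0 < d ->
  exists M0 : nat, forall M : nat, (M0 <= M)%N ->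
  exists k0 : nat, forall k : nat, (k0 <= k)%N ->
  forall (T : finType) (p v : 'I_k -> T -> R) (t0 : 'I_k -> T),
    laws p -> (forall i t, 0 < p i t -> `|v i t| <= B) ->
    (forall i, \sum_t p i t * v i t = 0) ->
    (forall i, 1 / 2 <= p i (t0 i)) ->
    (forall i, c <= \sum_(t | 1 / 2 <= `|v i t - v i (t0 i)|) p i t) ->
  forall u : R,
    expect p (fun x => expR (- (M%:R * `|u - normalized_sum v x|))) <=
      M%:R `^ (d - 1) * expR (- `|u|).
Proof.
move=> B0 c0 d0.
(* With [K] = (d / 2) ln M below, this [t] satisfies (t - 1) K = ln M. *)
pose t := 1 + 2 / d; pose q := char_rate c.
have q01 : 0 <= q < 1 by exact: char_rate01.
have q1 : 0 < 1 - q by case/andP: q01 => _; rewrite subr_gt0.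
pose C := 32 / (1 - q) + 2 * expR (2 * (t * B) ^+ 2).
have t1 : 1 <= t by rewrite lerDl divr_ge0 // ltW.
have C0 : 0 <= C by rewrite addr_ge0 ?divr_ge0 ?mulr_ge0 ?expR_ge0 // ltW.
have [L0 L01 hL0] := affine_le_expR C0 (divr_gt0 d0 (ltr0n _ 2)).
exists (Num.truncn (expR L0)).+1 => M hM.
have M_ge : expR L0 <= M%:R.
  by apply: (le_trans (ltW (truncnS_gt _))); rewrite ler_nat.
have Mpos : 0 < M%:R :> R by apply: lt_le_trans M_ge; rewrite expR_gt0.
pose L : R := ln M%:R.
have ML : M%:R = expR L by rewrite lnK.
have L0L : L0 <= L by rewrite -ler_expR -ML.
have L1 : 1 <= L by apply: le_trans L0L.
have M2L : 2 * L <= M%:R.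
  rewrite ML; apply: le_trans (expR_ge_affine_sq _); last by lra.
  by have := sqr_ge0 (L / 2 - 1); lra.
have M2 : 2 <= M%:R :> R by lra.
(* The window [1 / n] has width between 2 ln M / M and twice that. *)
pose n := Num.truncn (M%:R / (2 * L)).
have L20 : 0 < 2 * L by lra.
have n0 : (0 < n)%N by rewrite truncn_gt0 ler_pdivlMr // mul1r.
have nR : 1 <= n%:R :> R by rewrite ler1n.
have n_le : n%:R <= M%:R / (2 * L) by rewrite truncn_le divr_ge0 ?ltW.
have n_ge : M%:R <= 4 * L * n%:R.
  have : M%:R / (2 * L) < n%:R + 1 by rewrite natr1; exact: truncnS_gt.
  rewrite ltr_pdivrMr // => h.
  have : 0 <= (n%:R - 1) * L by rewrite mulr_ge0 ?subr_ge0 //; lra.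
  by lra.
(* Now [sqrt k] exceeds [B] times every frequency below [n <= M], and [2 * B]
   times the exponent [t] of the moment generating function. *)
pose k0 := (Num.truncn (((M%:R + 2 * t) * B) ^+ 2)).+1.
exists k0 => k hk T p v t0 pP vB v0 stay moves u.
have k_gt0 : (0 < k)%N by apply: leq_trans hk.
have sk : (M%:R + 2 * t) * B <= Num.sqrt k%:R.
  rewrite -[leLHS]ger0_norm; last first.
    by rewrite mulr_ge0 ?ltW // addr_gt0 // mulr_gt0 //; lra.
  rewrite -sqrtr_sqr ler_sqrt ?ler0n //; apply: (le_trans (ltW (truncnS_gt _))).
  by rewrite ler_nat.
have nB : n%:R * B <= Num.sqrt k%:R.
  apply: le_trans sk; rewrite ler_wpM2r ?(ltW B0) //.
  have : n%:R <= M%:R :> R.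
    by apply: (le_trans n_le); rewrite ler_pdivrMr //; nra.
  by lra.
have tB : t * B <= Num.sqrt k%:R / 2.
  have : 2 * t * B <= Num.sqrt k%:R.
    by apply: le_trans sk; rewrite ler_wpM2r ?(ltW B0) //; lra.
  by lra.
have conc := @normalized_concentration R T k p v t0 B c k_gt0 B0 c0 pP vB stay
  moves n u n0 nB.
have mgf := @normalized_mgf_le R T k p v B k_gt0 pP vB v0 t
  (le_trans ler01 t1) tB.
pose Y := normalized_sum v.
pose K := d / 2 * L.
apply: (@le_trans _ _ (expect p (fun x => expR (- `|u|) *
    (expR K * (`|u - Y x| <= n%:R^-1)%R%:R + M%:R^-1 * expR (t * `|Y x|))))).
  apply: le_expect => // x _; rewrite -/(Y x).
  have tri : - `|u - Y x| <= - `|u| + `|Y x|.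
    have := ler_normD (u - Y x) (Y x); rewrite subrK; lra.
  have Y0 := normr_ge0 (Y x); have D0 := normr_ge0 (u - Y x).
  have invM : M%:R^-1 = expR (- L) by rewrite expRN -ML.
  have [close|far] := leP `|u - Y x| n%:R^-1.
    apply: (@le_trans _ _ (expR (- `|u|) * expR `|Y x|)).
      by rewrite -expRD ler_expR; nra.
    rewrite ler_wpM2l ?expR_ge0 // mulr1.
    have [YK|KY] := leP `|Y x| K.
      apply: ler_wpDr; last by rewrite ler_expR.
      by rewrite mulr_ge0 ?expR_ge0 // invr_ge0 ltW.
    apply: ler_wpDl; rewrite ?expR_ge0 // invM -expRD ler_expR.
    have tK : (t - 1) * K = L by rewrite /t /K addrC addKr; field; rewrite gt_eqF.
    have : (t - 1) * K <= (t - 1) * `|Y x|.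
      by rewrite ler_wpM2l ?ltW // subr_gt0 /t ltrDl divr_gt0.
    by lra.
  rewrite mulr0 add0r invM -!expRD ler_expR.
  have far2 : 2 * L <= M%:R * `|u - Y x|.
    have : n%:R^-1 <= `|u - Y x| by exact: ltW.
    have : 2 * L / M%:R <= n%:R^-1.
      rewrite -[leLHS]invrK lef_pV2 ?posrE ?invr_gt0 ?divr_gt0 ?(ltr0n _ n) //.
      by rewrite invf_div.
    move=> h1 h2; have := le_trans h1 h2.
    by rewrite ler_pdivrMr // (mulrC M%:R).
  have : `|Y x| <= t * `|Y x| by rewrite -[leLHS]mul1r ler_wpM2r.
  by nra.
rewrite expectZ mulrC ler_wpM2r ?expR_ge0 // expectD !expectZ.
apply: (@le_trans _ _ (expR K * (8 / (n%:R * (1 - q))) +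
    M%:R^-1 * (2 * expR (2 * (t * B) ^+ 2)))).
  by rewrite lerD // ler_wpM2l ?expR_ge0 // invr_ge0 ltW.
have -> : M%:R `^ (d - 1) = M%:R^-1 * expR (d * L).
  rewrite /powR gt_eqF // -/L [M%:R in RHS]ML -expRN -expRD.
  by congr expR; ring.
have K1 : 1 <= expR K by rewrite -expR0 ler_expR /K mulr_ge0 ?divr_ge0 ?ltW //; lra.
apply: (@le_trans _ _ (M%:R^-1 * (expR K * (C * (1 + L))))); last first.
  rewrite ler_wpM2l ?invr_ge0 ?(ltW Mpos) //.
  have -> : expR (d * L) = expR K * expR (d / 2 * L).
    by rewrite -expRD /K; congr expR; field.
  by rewrite ler_wpM2l ?expR_ge0 // hL0.
have -> : expR K * (8 / (n%:R * (1 - q))) =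
    M%:R^-1 * (expR K * (8 * (M%:R / n%:R) / (1 - q))).
  by field; rewrite !gt_eqF // ltr0n.
rewrite -mulrDr ler_wpM2l ?invr_ge0 ?(ltW Mpos) //.
set A := 2 * expR _.
have A0 : 0 <= A by rewrite mulr_ge0 ?expR_ge0.
apply: (@le_trans _ _ (expR K * (8 * (M%:R / n%:R) / (1 - q) + A))).
  by rewrite mulrDr lerD2l ler_peMl.
rewrite ler_wpM2l ?expR_ge0 //.
have -> : C * (1 + L) = 32 / (1 - q) * (1 + L) + A * (1 + L).
  by rewrite /C mulrDl.
apply: lerD; last by rewrite ler_peMr //; lra.
rewrite [leRHS]mulrAC ler_wpM2r ?invr_ge0 ?(ltW q1) //.
have : M%:R / n%:R <= 4 * L by rewrite ler_pdivrMr // (lt_le_trans _ nR).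
by lra.
Qed.

End OneStepDecay.

(** * Markov chains that move at every scale *)

(** The atom of mass one half at the current position, together with a definite
    mass at distance at least [r] from it, is what makes a displacement
    non-degenerate at scale [r], wherever the chain stands. *)
Definition step_kernel (R : realType) (T : finType) (nu pos : T -> R)
    (r D c : R) (Q : T -> T -> R) : Prop :=
  [/\ (forall x, (forall y, 0 <= Q x y) /\ \sum_y Q x y = 1),
      (forall y, \sum_x nu x * Q x y = nu y),
      (forall x y, 0 < Q x y -> `|pos y - pos x| <= D * r),
      (forall x, 1 / 2 <= Q x x) &
      (forall x, 0 < nu x -> c <= \sum_(y | r <= `|pos y - pos x|) Q x y)].

Section Chain.
Variables (R : realType) (T : finType) (nu pos : T -> R) (M : nat) (D c : R).
Variables (Q : nat -> T -> T -> R) (n : nat).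
Hypotheses (nu0 : forall x, 0 <= nu x) (nu1 : \sum_x nu x = 1).
Hypotheses (D0 : 0 < D) (M2 : (2 <= M)%N) (MD : 8 * D <= M%:R).
Hypothesis kerQ : forall j, (j < n)%N ->
  step_kernel nu pos (M%:R ^+ j.+1) D c (Q j).

(** The conditional mean of the final position when the steps [j - 1], ..., [0]
    remain.  Step [j] acts at scale [M ^ j.+1], so that steps run from coarse to
    fine.  Successive conditional means differ by centered increments, whereas the
    displacements of the chain itself have a drift. *)
Fixpoint drifted (j : nat) (x : T) : R :=
  if j is j'.+1 then \sum_y Q j' x y * drifted j' y else pos x.

(** The scales of the remaining steps form a geometric series. *)
Lemma drifted_near j x : (j <= n)%N ->
  `|drifted j x - pos x| <= 2 * D * M%:R ^+ j.
Proof.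
elim: j x => [|j IH] x jn.
  by rewrite /= subrr normr0 mulr1 mulr_ge0 // ltW.
have [lawQ _ near _ _] := kerQ jn; have [Q0 Q1] := lawQ x.
have -> : drifted j.+1 x - pos x =
    \sum_y Q j x y * ((drifted j y - pos y) + (pos y - pos x)).
  under eq_bigr => y _ do rewrite addrA subrK mulrBr.
  by rewrite sumrB -mulr_suml Q1 mul1r.
apply: (le_trans (ler_norm_sum _ _ _)).
apply: (@le_trans _ _ (\sum_y Q j x y * (2 * D * M%:R ^+ j + D * M%:R ^+ j.+1))).
  apply: ler_sum => y _; rewrite normrM (ger0_norm (Q0 y)).
  have := Q0 y; rewrite le_eqVlt => /predU1P[<-|Qxy]; first by rewrite !mul0r.
  rewrite ler_wpM2l // (le_trans (ler_normD _ _)) // lerD ?near //.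
  exact: IH (ltnW jn).
rewrite -mulr_suml Q1 mul1r exprS.
have : 2 * (D * M%:R ^+ j) <= M%:R * (D * M%:R ^+ j).
  by rewrite ler_wpM2r ?ler_nat // mulr_ge0 ?exprn_ge0 // ltW.
by lra.
Qed.

(** The conditional probability that the sum of [k] independent final positions
    is [w] when [j] steps remain. *)
Fixpoint hit (k : nat) (w : R) (j : nat) (x : {ffun 'I_k -> T}) : R :=
  if j is j'.+1 then expect (fun i => Q j' (x i)) (hit w j')
  else (\sum_i pos (x i) == w)%R%:R.

Lemma expect_stationary k (K : T -> T -> R) (F : {ffun 'I_k -> T} -> R) :
  (forall y, \sum_x nu x * K x y = nu y) ->
  expect (fun=> nu) (fun x => expect (fun i => K (x i)) F) =
  expect (fun=> nu) F.
Proof.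
move=> stat; rewrite /expect /prod_law.
under eq_bigr => x _ do rewrite mulr_sumr.
rewrite exchange_big /=; apply: eq_bigr => y _.
under eq_bigr => x _ do rewrite mulrA.
rewrite -mulr_suml; congr (_ * _).
under [RHS]eq_bigr => i _ do rewrite -stat.
by rewrite bigA_distr_bigA; apply: eq_bigr => x _; rewrite big_split.
Qed.

Lemma expect_hit k w j : (j <= n)%N ->
  expect (fun=> nu) (@hit k w j) = expect (fun=> nu) (@hit k w 0).
Proof.
elim: j => // j IH jn; rewrite -(IH (ltnW jn)); apply: expect_stationary.
by have [] := kerQ jn.
Qed.

Lemma prod_law_gt0P k (p : 'I_k -> T -> R) (x : {ffun 'I_k -> T}) i :
  laws p -> 0 < prod_law p x -> 0 < p i (x i).
Proof.
move=> pP; rewrite /prod_law; have [p0 _] := pP i.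
rewrite lt0r => /andP[px _]; rewrite lt0r p0 andbT.
by apply: contraNneq px => pi0; rewrite (bigD1 i) //= pi0 mul0r.
Qed.

Variables (k : nat) (A : R).
Hypothesis one_step : forall (p v : 'I_k -> T -> R) (t0 : 'I_k -> T),
    laws p -> (forall i t, 0 < p i t -> `|v i t| <= 5 * D) ->
    (forall i, \sum_t p i t * v i t = 0) ->
    (forall i, 1 / 2 <= p i (t0 i)) ->
    (forall i, c <= \sum_(t | 1 / 2 <= `|v i t - v i (t0 i)|) p i t) ->
  forall u : R,
    expect p (fun x => expR (- (M%:R * `|u - normalized_sum v x|))) <=
      A * expR (- `|u|).
Hypotheses (k0 : (0 < k)%N) (A0 : 0 <= A).

(** Induction from the finest scale upwards.  In units of
    [sqrt k * M ^ j.+1], the conditional means at the next finer stage differ from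
    the current ones by a normalized sum of independent centered variables, and
    passing to the finer unit multiplies lengths by [M]: the weight becomes
    [expR (- (M * |u - Y|))], whose mean is the single-scale quantity. *)
Lemma hit_le w j (x : {ffun 'I_k -> T}) : (j <= n)%N ->
  (forall i, 0 < nu (x i)) ->
  hit w j x <= A ^+ j *
    expR (- (`|w - \sum_i drifted j (x i)| / (Num.sqrt k%:R * M%:R ^+ j))).
Proof.
have M0 : 0 < M%:R :> R by rewrite ltr0n; lia.
have s0 : 0 < Num.sqrt k%:R :> R by rewrite sqrtr_gt0 ltr0n.
elim: j x => [|j IH] x jn nux.
  rewrite /= mul1r; case: eqP => [->|_]; last exact: expR_ge0.
  by rewrite subrr normr0 mul0r oppr0 expR0.
have [lawQ stat near stay moves] := kerQ jn.
have Mj : 0 < M%:R ^+ j.+1 :> R by rewrite exprn_gt0.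
have Mj' : 0 < M%:R ^+ j :> R by rewrite exprn_gt0.
pose v (i : 'I_k) (t : T) := (drifted j t - drifted j.+1 (x i)) / M%:R ^+ j.+1.
pose u := (w - \sum_i drifted j.+1 (x i)) / (Num.sqrt k%:R * M%:R ^+ j.+1).
have pP : laws (fun i : 'I_k => Q j (x i)) by move=> i; exact: lawQ.
have DMj : 8 * D * M%:R ^+ j <= M%:R ^+ j.+1.
  by rewrite exprS ler_wpM2r // ltW.
have DMj1 : D * M%:R ^+ j <= D * M%:R ^+ j.+1.
  by rewrite ler_wpM2l ?(ltW D0) // ler_eXn2l ?ltr1n.
have ju y := drifted_near y (ltnW jn).
have jSu y := drifted_near y jn.
have step : expect (fun i => Q j (x i)) (fun y =>
    expR (- (M%:R * `|u - normalized_sum v y|))) <= A * expR (- `|u|).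
  apply: (@one_step (fun i => Q j (x i)) v x) => // i.
  - move=> t /near xt; rewrite /v normrM (@ger0_norm _ (_^-1)) ?invr_ge0 ?(ltW Mj) //.
    rewrite ler_pdivrMr //.
    have -> : drifted j t - drifted j.+1 (x i) = (drifted j t - pos t) +
        (pos t - pos (x i)) - (drifted j.+1 (x i) - pos (x i)) by ring.
    apply: (le_trans (ler_normB _ _)).
    apply: (le_trans (lerD (ler_normD _ _) (lexx _))).
    by have := ju t; have := jSu (x i); lra.
  - have [_ Q1] := lawQ (x i).
    under eq_bigr => t _ do rewrite /v mulrA mulrBr.
    by rewrite -mulr_suml sumrB -(mulr_suml _ _ _ (drifted _ _)) Q1 mul1r subrr mul0r.
  - apply: (le_trans (moves _ (nux i))).
    rewrite big_mkcond [leRHS]big_mkcond; apply: ler_sum => t _.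
    have [Q0 _] := lawQ (x i).
    case: ifP => h1; last by case: ifP.
    rewrite ifT // /v -mulrBl normrM (@ger0_norm _ (_^-1)) ?invr_ge0 ?(ltW Mj) //.
    rewrite ler_pdivlMr //.
    have -> : drifted j t - drifted j.+1 (x i) -
      (drifted j (x i) - drifted j.+1 (x i)) =
      (pos t - pos (x i)) -
        ((drifted j (x i) - pos (x i)) - (drifted j t - pos t)) by ring.
    have := lerB_dist (pos t - pos (x i))
      ((drifted j (x i) - pos (x i)) - (drifted j t - pos t)).
    have := ler_normB (drifted j (x i) - pos (x i)) (drifted j t - pos t).
    by have := ju t; have := ju (x i); lra.
have -> : `|w - \sum_i drifted j.+1 (x i)| / (Num.sqrt k%:R * M%:R ^+ j.+1) = `|u|.
  by rewrite /u normrM [in RHS](@ger0_norm _ (_^-1)) // invr_ge0 mulr_ge0 ?ltW.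
rewrite exprSr -mulrA; apply: (le_trans _ (ler_wpM2l (exprn_ge0 j A0) step)).
rewrite -expectZ; apply: le_expect => // y py.
have nuy i : 0 < nu (y i).
  have : 0 < Q j (x i) (y i) by exact: (prod_law_gt0P i pP py).
  move=> Qxy; rewrite -stat (bigD1 (x i)) //=; apply: ltr_wpDr.
    by apply: sumr_ge0 => z _; rewrite mulr_ge0 //; have [] := lawQ z.
  by rewrite mulr_gt0.
apply: (le_trans (IH y (ltnW jn) nuy)); rewrite ler_wpM2l ?exprn_ge0 //.
rewrite le_eqVlt; apply/orP; left; apply/eqP; congr (expR (- _)).
have -> : u - normalized_sum v y =
    (w - \sum_i drifted j (y i)) / (Num.sqrt k%:R * M%:R ^+ j) / M%:R.
  rewrite /u /normalized_sum /v -mulr_suml sumrB exprS.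
  by field; rewrite !gt_eqF.
rewrite normrM normrM !(@ger0_norm _ (_^-1)) ?invr_ge0 ?mulr_ge0 ?ltW //.
by rewrite mulrCA divff ?mulr1 // gt_eqF.
Qed.

Lemma sum_concentration_chain (w : R) :
  expect (fun _ : 'I_k => nu) (fun x => (\sum_i pos (x i) == w)%R%:R) <= A ^+ n.
Proof.
rewrite -[leLHS](expect_hit k w (leqnn n)).
apply: (@le_trans _ _ (expect (fun _ : 'I_k => nu) (fun=> A ^+ n * 1))).
  have lawnu : laws (fun _ : 'I_k => nu) by [].
  apply: le_expect => // x px.
  have nux i : 0 < nu (x i) by exact: (prod_law_gt0P i lawnu px).
  apply: (le_trans (hit_le w (leqnn n) nux)).
  rewrite ler_wpM2l ?exprn_ge0 // expR_le1 oppr_le0.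
by rewrite expectZ expect1 // mulr1.
Qed.

End Chain.

Lemma sum_concentration (R : realType) (D c d : R) :
  0 < D -> 0 < c -> 0 < d ->
  exists M0 : nat, forall M : nat, (M0 <= M)%N ->
  exists k0 : nat, forall k : nat, (k0 <= k)%N ->
  forall (T : finType) (nu pos : T -> R) (n : nat) (Q : nat -> T -> T -> R),
    (forall x, 0 <= nu x) -> \sum_x nu x = 1 ->
    (forall j, (j < n)%N -> step_kernel nu pos (M%:R ^+ j.+1) D c (Q j)) ->
  forall w : R,
    expect (fun _ : 'I_k => nu) (fun x => (\sum_i pos (x i) == w)%R%:R) <=
      (M%:R `^ (d - 1)) ^+ n.
Proof.
move=> D0 c0 d0; have D50 : 0 < 5 * D by rewrite mulr_gt0.
have [M0 hM0] := one_step_decay D50 c0 d0.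
exists (maxn (maxn M0 2) (Num.truncn (8 * D)).+1) => M.
rewrite !geq_max -andbA => /and3P[MM0 M2 MD].
have [k0 hk0] := hM0 M MM0; exists (maxn k0 1) => k.
rewrite geq_max => /andP[kk0 k1] T nu pos n Q nu0 nu1 kerQ w.
apply: (sum_concentration_chain nu0 nu1 D0 M2 _ kerQ) => //.
- by apply: (le_trans (ltW (truncnS_gt _))); rewrite ler_nat.
- exact: hk0.
Qed.

(** * A reversible kernel on cells of a given size *)

Section MetropolisKernel.
Variables (R : realType) (L : nat) (nu : 'I_L -> R) (H b : nat).
Implicit Types x y z : 'I_L.

Definition cell x : nat := (x %/ b)%N.

Definition near_cells (h : nat) x y : bool :=
  (cell y <= cell x + h)%N && (cell x <= cell y + h)%N.

Definition cell_mass x : R := \sum_(y | cell y == cell x) nu y.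

Definition far_cells x y : bool := near_cells H x y && ~~ near_cells 1 x y.

(** Dividing by the larger of the two cell masses makes [nu x * jump x y]
    symmetric.  It also keeps the total jump probability below one half, since
    each of the [2 * H + 1] cells within reach then contributes at most
    [1 / (4 * H + 2)]. *)
Definition jump x y : R :=
  if far_cells x y
  then nu y / ((4 * H + 2)%:R * Num.max (cell_mass x) (cell_mass y)) else 0.

Definition metropolis x y : R :=
  jump x y + (x == y)%:R * (1 - \sum_z jump x z).

Hypotheses (nu0 : forall x, 0 <= nu x) (b0 : (0 < b)%N).
Hypothesis perfect : forall x, 0 < nu x ->
  2 * (\sum_(y | near_cells 1 x y) nu y) <= \sum_(y | near_cells H x y) nu y.

Let C_gt0 : 0 < (4 * H + 2)%:R :> R.
Proof. by rewrite ltr0n addn_gt0 orbT. Qed.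

Lemma near_cells_sym h x y : near_cells h x y = near_cells h y x.
Proof. by rewrite /near_cells andbC. Qed.

Lemma cell_mass_ge0 x : 0 <= cell_mass x.
Proof. by apply: sumr_ge0. Qed.

Lemma le_cell_mass x : nu x <= cell_mass x.
Proof. by rewrite /cell_mass (bigD1 x) //= lerDl sumr_ge0. Qed.

Lemma cell_massE x y : cell x = cell y -> cell_mass x = cell_mass y.
Proof. by move=> xy; apply: eq_bigl => z; rewrite xy. Qed.

Lemma max_cell_mass_ge0 x y : 0 <= Num.max (cell_mass x) (cell_mass y).
Proof. by rewrite le_max cell_mass_ge0. Qed.

Lemma jump_ge0 x y : 0 <= jump x y.
Proof.
rewrite /jump; case: ifP => // _.
by rewrite divr_ge0 // mulr_ge0 ?max_cell_mass_ge0 // ltW.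
Qed.

Lemma jump_reversible x y : nu x * jump x y = nu y * jump y x.
Proof.
rewrite /jump /far_cells !(near_cells_sym _ y x) maxC.
by case: ifP => _; rewrite ?mulr0 // !mulrA (mulrC (nu y)).
Qed.

Lemma sum_density_cell_le1 (P : pred 'I_L) :
  (forall x y, P x -> P y -> cell x = cell y) ->
  \sum_(y | P y) nu y / cell_mass y <= 1.
Proof.
move=> Pcell; case: (pickP P) => [z Pz|P0]; last by rewrite big_pred0.
have -> : \sum_(y | P y) nu y / cell_mass y = (\sum_(y | P y) nu y) / cell_mass z.
  rewrite mulr_suml; apply: eq_bigr => y Py.
  by rewrite (cell_massE (Pcell _ _ Py Pz)).
have := cell_mass_ge0 z; rewrite le_eqVlt => /predU1P[<-|mz].
  by rewrite invr0 mulr0.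
rewrite ler_pdivrMr // mul1r /cell_mass big_mkcond [leRHS]big_mkcond.
apply: ler_sum => y _; case: ifP => Py; last by case: ifP.
by rewrite (Pcell _ _ Py Pz) eqxx.
Qed.

Lemma sum_jump_le x : \sum_y jump x y <= 1 / 2.
Proof.
pose idx y : 'I_(2 * H).+1 := inord (cell y + H - cell x).
apply: (@le_trans _ _
    (\sum_(y | near_cells H x y) nu y / cell_mass y / (4 * H + 2)%:R)).
  rewrite [leRHS]big_mkcond; apply: ler_sum => y _; rewrite /jump.
  case: ifP => [/andP[-> _]|_]; last first.
    by case: ifP => // _; rewrite !divr_ge0 ?cell_mass_ge0 // ltW.
  have := nu0 y; rewrite le_eqVlt => /predU1P[<-|ny]; first by rewrite !mul0r.
  have my : 0 < cell_mass y by apply: lt_le_trans ny (le_cell_mass y).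
  rewrite invfM mulrCA [leRHS]mulrC.
  rewrite ler_wpM2l ?invr_ge0 ?(ltW C_gt0) // ler_wpM2l //.
  by rewrite lef_pV2 ?posrE ?lt_max ?my ?orbT // le_max lexx orbT.
rewrite -mulr_suml ler_pdivrMr //.
have -> : 1 / 2 * (4 * H + 2)%:R = \sum_(i < (2 * H).+1) 1 :> R.
  rewrite sumr_const card_ord; have -> : (4 * H + 2 = 2 * (2 * H).+1)%N by lia.
  by rewrite natrM; field.
rewrite (partition_big idx xpredT) //=; apply: ler_sum => i _.
apply: sum_density_cell_le1 => y z /andP[ny /eqP iy] /andP[nz /eqP iz].
have := congr1 (@nat_of_ord _) (etrans iy (esym iz)); rewrite /idx !inordK.
- by move: ny nz; rewrite /near_cells; lia.
- by move: nz; rewrite /near_cells; lia.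
- by move: ny; rewrite /near_cells; lia.
Qed.

(** Here perfectness enters.  The total mass [W] of the cells at distance 2 to [H]
    is at least the mass of the cell of [x], and at least the mass of
    each of these cells; hence [W] bounds every denominator. *)
Lemma sum_jump_ge x : 0 < nu x -> (4 * H + 2)%:R^-1 <= \sum_y jump x y.
Proof.
move=> nx; pose W := \sum_(y | far_cells x y) nu y.
have mass_le y : far_cells x y -> cell_mass y <= W.
  move=> xy; rewrite /cell_mass /W big_mkcond [leRHS]big_mkcond.
  apply: ler_sum => z _; case: ifP => [/eqP zy|_]; last by case: ifP.
  by move: xy; rewrite /far_cells /near_cells zy => ->.
have mass_leW : cell_mass x <= W.
  have : \sum_(y | near_cells H x y) nu y <=
      W + \sum_(y | near_cells 1 x y) nu y.
    rewrite /W big_mkcond [X in X + _]big_mkcond [X in _ + X]big_mkcond.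
    rewrite -big_split /=; apply: ler_sum => y _; rewrite /far_cells.
    by case: (near_cells H x y); case: (near_cells 1 x y); rewrite /= ?addr0 ?add0r.
  have : cell_mass x <= \sum_(y | near_cells 1 x y) nu y.
    rewrite /cell_mass big_mkcond [leRHS]big_mkcond; apply: ler_sum => y _.
    case: ifP => [/eqP yx|_]; last by case: ifP.
    by rewrite /near_cells yx leq_addr.
  by have := perfect nx; lra.
have W0 : 0 < W by apply: lt_le_trans mass_leW; apply: lt_le_trans nx (le_cell_mass x).
apply: (@le_trans _ _ (\sum_(y | far_cells x y) nu y / ((4 * H + 2)%:R * W))).
  by rewrite -mulr_suml -/W invfM mulrCA divff ?mulr1 // gt_eqF.
rewrite big_mkcond; apply: ler_sum => y _; rewrite /jump; case: ifP => // xy.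
have := nu0 y; rewrite le_eqVlt => /predU1P[<-|ny]; first by rewrite !mul0r.
have my : 0 < cell_mass y by apply: lt_le_trans ny (le_cell_mass y).
rewrite ler_wpM2l // lef_pV2 ?posrE ?mulr_gt0 ?lt_max ?my ?orbT //.
by rewrite ler_wpM2l ?(ltW C_gt0) // ge_max mass_leW mass_le.
Qed.

Lemma near_cells_dist h x y :
  near_cells h x y -> `|(y : nat)%:R - (x : nat)%:R| <= (h.+1 * b)%:R :> R.
Proof.
rewrite /near_cells /cell => /andP[yx xy].
have xy' : (x <= y + h.+1 * b)%N.
  by have := divn_eq x b; have := divn_eq y b;
  have := ltn_pmod x b0; nia.
have yx' : (y <= x + h.+1 * b)%N.
  by have := divn_eq x b; have := divn_eq y b;
  have := ltn_pmod y b0; nia.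
by move: xy' yx'; rewrite -!(ler_nat R) !natrD ler_norml; lra.
Qed.

Lemma far_cells_dist x y :
  far_cells x y -> b%:R <= `|(y : nat)%:R - (x : nat)%:R| :> R.
Proof.
rewrite /far_cells /near_cells negb_and -!ltnNge /cell => /andP[_ /orP[]] h.
  have : (x + b <= y)%N.
    by have := divn_eq x b; have := divn_eq y b;
    have := ltn_pmod x b0; nia.
  by rewrite -(ler_nat R) natrD; have := ler_norm (y%:R - x%:R : R); lra.
have : (y + b <= x)%N.
  by have := divn_eq x b; have := divn_eq y b;
  have := ltn_pmod y b0; nia.
by rewrite distrC -(ler_nat R) natrD; have := ler_norm (x%:R - y%:R : R); lra.
Qed.

Lemma metropolis_step_kernel :
  step_kernel nu (fun x => (x : nat)%:R) b%:R (H.+1)%:R (4 * H + 2)%:R^-1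
    metropolis.
Proof.
have stay x : 1 / 2 <= 1 - \sum_z jump x z by have := sum_jump_le x; lra.
have diag (F : 'I_L -> R) x : \sum_y (x == y)%:R * F y = F x.
  rewrite (bigD1 x) //= eqxx mul1r big1 ?addr0 // => y.
  by rewrite eq_sym => /negbTE ->; rewrite mul0r.
split.
- move=> x; split.
    move=> y; rewrite addr_ge0 ?jump_ge0 // mulr_ge0 //.
    by apply: le_trans (stay x).
  by rewrite big_split /= (diag (fun=> _)) addrC subrK.
- move=> y; rewrite /metropolis.
  under eq_bigr => x _ do rewrite mulrDr jump_reversible eq_sym mulrCA.
  rewrite big_split /= (diag (fun x => nu x * (1 - \sum_z jump x z))).
  by rewrite -mulr_sumr mulrBr mulr1 addrC subrK.
- move=> x y; rewrite /metropolis; case: (eqVneq x y) => [->|_].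
    by rewrite subrr normr0 mulr_ge0.
  rewrite mul0r addr0 /jump; case: ifP => [/andP[+ _] _|]; last by rewrite ltxx.
  by rewrite -natrM; exact: near_cells_dist.
- move=> x; rewrite /metropolis eqxx; apply: le_trans (stay x) _.
  by rewrite mul1r lerDr jump_ge0.
- move=> x nx; apply: le_trans (sum_jump_ge nx) _.
  rewrite [leRHS]big_mkcond; apply: ler_sum => y _.
  have Q0 : jump x y <= metropolis x y.
    by rewrite /metropolis lerDl mulr_ge0 // (le_trans _ (stay x)).
  case: ifP => // /negP far.
  by rewrite /jump; case: ifP => // /far_cells_dist.
Qed.

End MetropolisKernel.

(** * Energies of iterated convolutions on a finite abelian group *)

Section FinfunCons.
Variables (T : finType) (k : nat).

Definition ffun_cons (t : T) (y : {ffun 'I_k -> T}) : {ffun 'I_k.+1 -> T} :=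
  [ffun i => if unlift ord0 i is Some j then y j else t].

Lemma ffun_cons0 t y : ffun_cons t y ord0 = t.
Proof. by rewrite ffunE unlift_none. Qed.

Lemma ffun_consS t y j : ffun_cons t y (lift ord0 j) = y j.
Proof. by rewrite ffunE liftK. Qed.

Lemma big_ffun_cons (R : nmodType) (F : {ffun 'I_k.+1 -> T} -> R) :
  \sum_x F x = \sum_t \sum_y F (ffun_cons t y).
Proof.
rewrite pair_big (reindex (fun u : T * {ffun 'I_k -> T} => ffun_cons u.1 u.2)) //=.
exists (fun x : {ffun 'I_k.+1 -> T} => (x ord0, [ffun j => x (lift ord0 j)])).
  move=> [t y] _ /=; rewrite ffun_cons0; congr (_, _).
  by apply/ffunP => j; rewrite ffunE ffun_consS.
move=> x _ /=; apply/ffunP => i; rewrite ffunE.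
by case: unliftP => [j|] -> //; rewrite ffunE.
Qed.

End FinfunCons.

Section Energy.
Variables (R : realType) (G : finZmodType) (nu : G -> R).
Implicit Types f g : G -> R.

Definition convolve f (z : G) : R := \sum_x nu x * f (z - x).

Definition energy f : R := \sum_z f z ^+ 2.

Hypotheses (nu0 : forall x, 0 <= nu x) (nu1 : \sum_x nu x = 1).

Lemma convolve_ge0 f : (forall z, 0 <= f z) -> forall z, 0 <= convolve f z.
Proof. by move=> f0 z; apply: sumr_ge0 => x _; rewrite mulr_ge0. Qed.

Lemma sum_shift f (y : G) : \sum_z f (z + y) = \sum_z f z.
Proof. by rewrite [RHS](reindex_inj (addIr y)). Qed.

Lemma sum_convolve f : \sum_z convolve f z = \sum_z f z.
Proof.
rewrite exchange_big /=.
under eq_bigr => x _ do rewrite -mulr_sumr (sum_shift f).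
by rewrite -mulr_suml nu1 mul1r.
Qed.

Lemma sqr_sum_mul_le f g :
  (\sum_z f z * g z) ^+ 2 <= (\sum_z f z ^+ 2) * (\sum_z g z ^+ 2).
Proof.
have : 0 <= \sum_x \sum_y (f x * g y - f y * g x) ^+ 2.
  by apply: sumr_ge0 => x _; apply: sumr_ge0 => y _; exact: sqr_ge0.
have -> : \sum_x \sum_y (f x * g y - f y * g x) ^+ 2 =
    \sum_x \sum_y (f x ^+ 2 * g y ^+ 2) + \sum_x \sum_y (g x ^+ 2 * f y ^+ 2)
    - 2 * \sum_x \sum_y (f x * g x) * (f y * g y).
  rewrite mulr_sumr -sumrN -!big_split; apply: eq_bigr => x _ /=.
  rewrite mulr_sumr -sumrN -!big_split; apply: eq_bigr => y _ /=.
  by ring.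
have prod (F1 F2 : G -> R) :
    \sum_x \sum_y F1 x * F2 y = (\sum_x F1 x) * (\sum_y F2 y).
  by rewrite mulr_suml; apply: eq_bigr => x _; rewrite mulr_sumr.
rewrite (prod (fun x => f x ^+ 2) (fun x => g x ^+ 2)).
rewrite (prod (fun x => g x ^+ 2) (fun x => f x ^+ 2)).
rewrite (prod (fun x => f x * g x) (fun x => f x * g x)) -expr2.
by lra.
Qed.

(** Convolution by [nu] is a normal operator: the adjoint, convolution by the
    reflected law, has the same energy, because [g (z + x) * g (z + y)] and
    [g (z - y) * g (z - x)] are translates of each other. *)
Lemma energy_convolve_sqr_le f :
  energy (convolve f) ^+ 2 <= energy f * energy (convolve (convolve f)).
Proof.
pose adj g z := \sum_x nu x * g (z + x).
have adjP g : \sum_z convolve f z * g z = \sum_z f z * adj g z.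
  under eq_bigr => z _ do rewrite mulr_suml.
  under [RHS]eq_bigr => z _ do rewrite mulr_sumr.
  rewrite exchange_big [RHS]exchange_big /=; apply: eq_bigr => x _.
  rewrite -(sum_shift _ x); apply: eq_bigr => z _.
  by rewrite addrK -mulrA mulrCA.
have expand (s : G -> G -> G) g : \sum_z (\sum_x nu x * g (s z x)) ^+ 2 =
    \sum_x \sum_y nu x * nu y * \sum_z g (s z x) * g (s z y).
  under eq_bigr => z _ do rewrite expr2 mulr_suml.
  rewrite exchange_big; apply: eq_bigr => x _ /=.
  under eq_bigr => z _ do rewrite mulr_sumr.
  rewrite exchange_big; apply: eq_bigr => y _ /=.
  by rewrite mulr_sumr; apply: eq_bigr => z _; ring.
have normal g : energy (adj g) = energy (convolve g).
  rewrite /energy (expand (fun z x => z + x)) (expand (fun z x => z - x)).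
  apply: eq_bigr => x _; apply: eq_bigr => y _; congr (_ * _).
  rewrite -[RHS](sum_shift _ (x + y)); apply: eq_bigr => z _.
  have -> : z + (x + y) - x = z + y by rewrite addrA addrAC addrK.
  by rewrite addrA addrK mulrC.
have -> : energy (convolve f) = \sum_z f z * adj (convolve f) z.
  by rewrite -adjP; apply: eq_bigr => z _; rewrite expr2.
apply: (le_trans (sqr_sum_mul_le _ _)).
by rewrite -!/(energy _) normal.
Qed.

Definition iter_energy f n := energy (iter n convolve f).

Lemma energy_gt0 f : 0 < \sum_z f z -> 0 < energy f.
Proof.
move=> f0; rewrite lt0r sumr_ge0 ?andbT => [|z _]; last exact: sqr_ge0.
apply: contraTneq f0 => /eqP; rewrite psumr_eq0 => [/allP h|z _]; last exact: sqr_ge0.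
rewrite big1 ?ltxx // => z _.
by have := h z (mem_index_enum z); rewrite sqrf_eq0 => /eqP.
Qed.

(** Energies of the iterates are log-convex, so a loss visible only after many
    convolutions is already shared by the first one. *)
Lemma energy_convolve_pow_le f K : 0 < \sum_z f z ->
  energy (convolve f) ^+ K.+1 <= energy f ^+ K * iter_energy f K.+1.
Proof.
move=> f0.
have pos n : 0 < iter_energy f n.
  apply: energy_gt0; elim: n => //= n IH; by rewrite sum_convolve.
have ratio n : energy (convolve f) * iter_energy f n <= energy f * iter_energy f n.+1.
  elim: n => [|n IH]; first by rewrite mulrC.
  rewrite -(ler_pM2r (pos n)).
  have := energy_convolve_sqr_le (iter n convolve f).
  rewrite -/(iter_energy f n) -[energy (convolve _)]/(iter_energy f n.+1).
  rewrite -[energy (convolve (convolve _))]/(iter_energy f n.+2) => h.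
  have e0 : 0 <= energy f by apply: ltW; exact: (pos 0%N).
  have := ler_wpM2l e0 h; have := ler_wpM2r (ltW (pos n.+1)) IH.
  by lra.
elim: K => [|K IH]; first by rewrite expr0 mul1r expr1.
have e1 : 0 <= energy (convolve f) by apply: ltW; exact: (pos 1%N).
have e0 : 0 <= energy f by apply: ltW; exact: (pos 0%N).
rewrite exprS; apply: (le_trans (ler_wpM2l e1 IH)).
rewrite mulrCA exprSr -mulrA ler_wpM2l ?exprn_ge0 //.
Qed.

Lemma iter_convolveE f n z :
  iter n convolve f z = expect (fun _ : 'I_n => nu) (fun x => f (z - \sum_i x i)).
Proof.
elim: n z => [|n IH] z.
  rewrite /expect (bigD1 [ffun=> 0]) //= [X in _ + X]big1 ?addr0 => [|x]; last first.
    have -> : x = [ffun=> 0] by apply/ffunP => -[].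
    by rewrite eqxx.
  by rewrite /prod_law !big_ord0 mul1r subr0.
rewrite /expect big_ffun_cons /= /convolve; apply: eq_bigr => t _.
rewrite IH /expect mulr_sumr; apply: eq_bigr => y _.
rewrite /prod_law !big_ord_recl ffun_cons0 mulrA opprD addrA.
by congr (_ * _ * f (_ - _)); apply: eq_bigr => j _; rewrite ffun_consS.
Qed.

Lemma sum_indicator (E : {set G}) : \sum_z (z \in E)%:R = #|E|%:R :> R.
Proof.
by rewrite -natr_sum -sum1_card [in RHS]big_mkcond.
Qed.

(** The energy of an iterate is at most its maximum times its total mass
    [#|E|], and the maximum is at most [#|E|] times the largest atom of the
    convolution power. *)
Lemma energy_indicator_le (E : {set G}) (K : nat) (beta : R) : (0 < #|E|)%N ->
  (forall w, expect (fun _ : 'I_K.+1 => nu)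
     (fun x => (\sum_i x i == w)%:R) <= beta) ->
  energy (convolve (fun z => (z \in E)%:R)) ^+ K.+1 <=
    #|E|%:R ^+ K.+1 * (#|E|%:R * beta).
Proof.
move=> E0 hbeta; pose f z : R := (z \in E)%:R; rewrite -/f.
have sumf : \sum_z f z = #|E|%:R by exact: sum_indicator.
have f0 : 0 < \sum_z f z by rewrite sumf ltr0n.
have energyf : energy f = #|E|%:R.
  rewrite -sumf; apply: eq_bigr => z _; rewrite /f.
  by case: (z \in E); rewrite ?expr1n ?expr0n.
apply: (le_trans (energy_convolve_pow_le K f0)); rewrite energyf.
rewrite [leRHS]mulrA exprSr -!mulrA ler_wpM2l ?exprn_ge0 //.
have iter0 n z : 0 <= iter n convolve f z.
  elim: n z => [|n IH] z /=; [exact: ler0n|exact: convolve_ge0].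
have iter_sum n : \sum_z iter n convolve f z = #|E|%:R.
  by elim: n => [|n IH] //=; rewrite sum_convolve.
have iter_le z : iter K.+1 convolve f z <= #|E|%:R * beta.
  rewrite iter_convolveE.
  have -> : #|E|%:R * beta = \sum_(e in E) beta by rewrite sumr_const mulr_natl.
  apply: (@le_trans _ _ (\sum_(e in E) expect (fun _ : 'I_K.+1 => nu)
    (fun x => (\sum_i x i == z - e)%:R))); last by apply: ler_sum => e _.
  rewrite -expect_sum; apply: le_expect => // x _.
  rewrite /f; case: (boolP (_ \in E)) => [xE|_]; last exact: sumr_ge0.
  rewrite (bigD1 _ xE) /= subKr eqxx lerDl; exact: sumr_ge0.
apply: (@le_trans _ _ (\sum_z #|E|%:R * beta * iter K.+1 convolve f z)).
  by apply: ler_sum => z _; rewrite expr2 ler_wpM2r.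
by rewrite -mulr_sumr iter_sum mulrC.
Qed.

End Energy.

(** * Energy gain for laws that are perfect at every scale *)

(** Uniform perfectness at a single scale: the cells at distance 2 to [H] weigh
    at least as much as the cells at distance at most 1. *)
Definition scale_perfect (R : realType) (L : nat) (nu : 'I_L -> R) (H b : nat) :=
  forall x, 0 < nu x ->
    2 * (\sum_(y | near_cells b 1 x y) nu y) <=
    \sum_(y | near_cells b H x y) nu y.

Lemma val_sum_Zp (L k : nat) (x : {ffun 'I_k -> 'I_L.+1}) :
  (\sum_i x i : 'I_L.+1) = ((\sum_i (x i : nat)) %% L.+1)%N :> nat.
Proof.
elim/big_ind2 : _ => [|a m b n am bn|i _] /=; first by rewrite mod0n.
  by rewrite am bn modnDm.
by rewrite modn_small.
Qed.

(** A sum in the cyclic group takes a given value only if the sum of the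
    representatives takes one of [K.+1] integer values, and each of these has small
    probability by concentration of the chain. *)
Lemma energy_indicator_perfect_le (R : realType) (H : nat) (d : R) : 0 < d ->
  exists ell K : nat, (0 < ell)%N /\
  forall (L : nat) (nu : 'I_L.+1 -> R) (n : nat),
    (forall x, 0 <= nu x) -> \sum_x nu x = 1 ->
    (forall j, (j < n)%N -> scale_perfect nu H (2 ^ (ell * j.+1))) ->
  forall E : {set 'I_L.+1}, (0 < #|E|)%N ->
  energy (convolve nu (fun z => (z \in E)%:R)) ^+ K.+1 <=
    #|E|%:R ^+ K.+1 *
      (#|E|%:R * (K.+1%:R * 2 `^ ((d - 1) * (ell * n)%:R))).
Proof.
move=> d0.
have D0 : 0 < H.+1%:R :> R by rewrite ltr0n.
have c0 : 0 < (4 * H + 2)%:R^-1 :> R by rewrite invr_gt0 ltr0n addn_gt0 orbT.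
have [M0 hM0] := sum_concentration D0 c0 d0.
have [|k0 hk0] := hM0 (2 ^ M0.+1)%N.
  by apply: ltnW; apply: (ltn_trans (ltnSn M0)); exact: ltn_expl.
exists M0.+1, k0; split=> // L nu n nu0 nu1 perf E E0.
apply: energy_indicator_le => // w.
pose s (x : {ffun 'I_k0.+1 -> 'I_L.+1}) : R := \sum_i (x i : nat)%:R.
apply: (@le_trans _ _ (\sum_(j < k0.+1) expect (fun _ : 'I_k0.+1 => nu)
    (fun x => (s x == (w + j * L.+1)%:R)%R%:R))).
  rewrite -expect_sum; apply: le_expect => [//|x _].
  case: eqP => [xw|_]; last by apply: sumr_ge0.
  have sxw := congr1 (@nat_of_ord _) xw; rewrite val_sum_Zp in sxw.
  pose t := (\sum_i (x i : nat))%N; rewrite -/t in sxw.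
  have tlt : (t %/ L.+1 < k0.+1)%N.
    rewrite ltn_divLR //; apply: (@leq_ltn_trans (\sum_(i < k0.+1) L)).
      by apply: leq_sum => i _; rewrite -ltnS.
    by rewrite sum_nat_const card_ord ltn_mul2l ltnSn.
  rewrite (bigD1 (Ordinal tlt)) //= /s -natr_sum -/t -sxw addnC -divn_eq eqxx.
  by rewrite lerDl sumr_ge0.
have -> : k0.+1%:R * 2 `^ ((d - 1) * (M0.+1 * n)%:R) =
    \sum_(j < k0.+1) 2 `^ ((d - 1) * (M0.+1 * n)%:R) :> R.
  by rewrite sumr_const card_ord mulr_natl.
apply: ler_sum => j _.
have -> : 2 `^ ((d - 1) * (M0.+1 * n)%:R) = ((2 ^ M0.+1)%:R `^ (d - 1)) ^+ n :> R.
  rewrite -powR_mulrn ?powR_ge0 // natrX -powR_mulrn // -!powRrM natrM.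
  by congr (2 `^ _); ring.
pose Q i := metropolis nu H (2 ^ (M0.+1 * i.+1)).
apply: (hk0 k0.+1 _ _ nu (fun x => (x : nat)%:R) n Q) => // i ni.
have -> : (2 ^ M0.+1)%:R ^+ i.+1 = (2 ^ (M0.+1 * i.+1))%:R :> R.
  by rewrite expnM [RHS]natrX.
apply: metropolis_step_kernel => //; first by rewrite expn_gt0.
exact: perf.
Qed.

(** * Power sums and level sets *)

Section PowerSums.
Variable R : realType.
Implicit Types a q r tau : R.

(** When [q < 2] the power is not dominated by the square.  The part below [tau]
    is compared with the mass, the part above with the square. *)
Lemma powR_split_le a q r tau : 0 <= a <= 1 -> 0 < tau -> 0 < r <= 1 ->
  1 + r <= q -> a `^ q <= tau `^ r * a + tau `^ (r - 1) * a ^+ 2.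
Proof.
move=> /andP[a0 a1] tau0 /andP[r0 r1] rq.
have [->|an0] := eqVneq a 0.
  by rewrite powR0 ?mulr0 ?expr0n ?mulr0 ?addr0 // gt_eqF //; lra.
have {}a0 : 0 < a by rewrite lt0r an0.
apply: (@le_trans _ _ (a `^ (1 + r))).
  by rewrite ger_powR // a0.
rewrite [a `^ (1 + r)]powRD ?an0 ?implybT // powRr1 ?(ltW a0) //.
have [atau|taua] := leP a tau.
  rewrite mulrC; apply: ler_wpDr; first by rewrite mulr_ge0 ?powR_ge0 ?sqr_ge0.
  by rewrite ler_wpM2r ?(ltW a0) // ge0_ler_powR ?nnegrE ?(ltW r0) ?(ltW a0) ?(ltW tau0).
apply: ler_wpDl; first by rewrite mulr_ge0 ?powR_ge0 // ltW.
have -> : a `^ r = a * a `^ (r - 1).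
  by rewrite -{2}(powRr1 (ltW a0)) -powRD ?an0 ?implybT // addrC subrK.
rewrite mulrA -expr2 mulrC ler_wpM2r ?sqr_ge0 //.
have -> : r - 1 = - (1 - r) by ring.
rewrite !powRN lef_pV2 ?posrE ?powR_gt0 //.
by rewrite ge0_ler_powR ?nnegrE ?subr_ge0 ?(ltW tau0) ?(ltW taua) ?(ltW a0).
Qed.

Lemma powR_sum_le (n : nat) (a : 'I_n -> R) q : 0 < q ->
  (forall i, 0 <= a i) ->
  (\sum_i a i) `^ q <= n%:R `^ q * \sum_i a i `^ q.
Proof.
move=> q0 a0; pose S := \sum_i a i `^ q.
have S0 : 0 <= S by apply: sumr_ge0 => i _; exact: powR_ge0.
have le_a i : a i <= S `^ q^-1.
  have -> : a i = (a i `^ q) `^ q^-1 by rewrite -powRrM divff ?powRr1 // gt_eqF.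
  rewrite ge0_ler_powR ?nnegrE ?invr_ge0 ?powR_ge0 ?(ltW q0) //.
  by rewrite /S (bigD1 i) //= lerDl sumr_ge0 // => j _; exact: powR_ge0.
have -> : n%:R `^ q * S = (n%:R * S `^ q^-1) `^ q.
  by rewrite powRM ?powR_ge0 // -powRrM mulVf ?gt_eqF // powRr1.
rewrite ge0_ler_powR ?nnegrE ?(ltW q0) ?sumr_ge0 ?mulr_ge0 ?powR_ge0 //.
apply: (le_trans (ler_sum _ (fun i _ => le_a i))).
by rewrite sumr_const card_ord mulr_natl.
Qed.

Lemma sum_powR_le_sup (G : finType) (h : G -> R) (t q : R) : 1 < q ->
  (forall z, 0 <= h z <= t) -> \sum_z h z <= 1 ->
  \sum_z h z `^ q <= t `^ (q - 1).
Proof.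
move=> q1 ht h1; rewrite -[leRHS]mulr1.
apply: le_trans (ler_wpM2l (powR_ge0 _ _) h1); rewrite mulr_sumr.
apply: ler_sum => z _; have /andP[h0 hzt] := ht z.
have -> : h z `^ q = h z `^ (q - 1) * h z.
  have [->|hn0] := eqVneq (h z) 0; first by rewrite mulr0 powR0 // gt_eqF //; lra.
  by rewrite -{3}(powRr1 h0) -powRD ?hn0 ?implybT // subrK.
rewrite ler_wpM2r // ge0_ler_powR ?nnegrE ?(le_trans h0 hzt) //; lra.
Qed.

End PowerSums.

Section LevelSets.
Variables (R : realType) (G : finZmodType) (nu f : G -> R) (q : R) (m : nat).
Hypotheses (q1 : 1 < q) (nu0 : forall x, 0 <= nu x) (nu1 : \sum_x nu x = 1).
Hypotheses (f0 : forall z, 0 <= f z) (f1 : \sum_z f z = 1).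

Definition level (j : nat) : {set G} :=
  finset (fun z => 2 ^- j.+1 < f z <= 2 ^- j).

(** The last index [m] carries the tail of [f] below [2 ^- m]; on the other levels
    [f] is replaced by a multiple of an indicator that dominates it. *)
Definition level_part (j : 'I_m.+1) (z : G) : R :=
  if (j < m)%N then 2 ^- j * (z \in level j)%:R
  else if f z <= 2 ^- m then f z else 0.

Let f_le1 z : f z <= 1.
Proof. by rewrite -f1 (bigD1 z) //= lerDl sumr_ge0. Qed.

Lemma level_part_ge0 j z : 0 <= level_part j z.
Proof.
rewrite /level_part; case: ifP => _; last by case: ifP.
by rewrite mulr_ge0 // invr_ge0 exprn_ge0.
Qed.

Lemma le_sum_level_part z : f z <= \sum_j level_part j z.
Proof.
have [fm|mf] := leP (f z) (2 ^- m).
  have fE : level_part ord_max z = f z by rewrite /level_part ltnn fm.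
  rewrite (bigD1 ord_max) //= fE lerDl.
  by apply: sumr_ge0 => j _; exact: level_part_ge0.
have /ex_minnP[j] : exists j, 2 ^- j.+1 < f z.
  exists m; apply: le_lt_trans mf; rewrite lef_pV2 ?posrE ?exprn_gt0 //.
  by rewrite ler_eXn2l ?ltr1n.
move=> fj minj.
have jm : (j < m)%N.
  case: m mf minj => [|m'] mf minj; last by rewrite ltnS minj.
  by move: mf; rewrite expr0 invr1 ltNge f_le1.
have fj' : f z <= 2 ^- j.
  case: j {fj jm} minj => [|j] minj; first by rewrite expr0 invr1.
  by rewrite leNgt; apply/negP => /minj; rewrite ltnn.
have jm1 : (j < m.+1)%N by apply: ltnW.
have fE : level_part (Ordinal jm1) z = 2 ^- j.
  by rewrite /level_part /= jm inE fj fj' mulr1.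
rewrite (bigD1 (Ordinal jm1)) //= fE.
apply: (le_trans fj'); rewrite lerDl.
by apply: sumr_ge0 => i _; exact: level_part_ge0.
Qed.

Lemma convolve_level_sum_le :
  \sum_z convolve nu f z `^ q <=
  m.+1%:R `^ q * \sum_(j < m.+1) \sum_z convolve nu (level_part j) z `^ q.
Proof.
have q0 : 0 < q by apply: lt_trans q1.
rewrite exchange_big mulr_sumr; apply: ler_sum => z _.
apply: le_trans (powR_sum_le q0 (fun j => convolve_ge0 nu0 (level_part_ge0 j) z)).
rewrite ge0_ler_powR ?nnegrE ?(ltW q0) ?convolve_ge0 //.
  by apply: sumr_ge0 => j _; apply: convolve_ge0 => // ?; exact: level_part_ge0.
rewrite exchange_big /=; apply: ler_sum => x _.
by rewrite -mulr_sumr ler_wpM2l // le_sum_level_part.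
Qed.

Lemma convolve_le (h : G -> R) t : (forall z, h z <= t) ->
  forall z, convolve nu h z <= t.
Proof.
move=> ht z; rewrite -[leRHS]mul1r -nu1 mulr_suml.
by apply: ler_sum => x _; rewrite ler_wpM2l.
Qed.

Lemma tail_part_le :
  \sum_z convolve nu (level_part ord_max) z `^ q <= (2 ^- m) `^ (q - 1).
Proof.
have part_le z : level_part ord_max z <= 2 ^- m.
  by rewrite /level_part ltnn; case: ifP => // _; rewrite invr_ge0 exprn_ge0.
apply: sum_powR_le_sup => // [z|].
  by rewrite convolve_ge0 ?convolve_le // => ?; exact: level_part_ge0.
rewrite sum_convolve // -f1; apply: ler_sum => z _.
by rewrite /level_part ltnn; case: ifP.
Qed.

Variables (K : nat) (beta theta r : R).
Hypotheses (beta0 : 0 < beta) (theta0 : 0 < theta) (r01 : 0 < r <= 1).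
Hypothesis rq : 1 + r <= q.
Hypothesis energyE : forall E : {set G}, (0 < #|E|)%N ->
  energy (convolve nu (fun z => (z \in E)%:R)) ^+ K.+1 <=
    #|E|%:R ^+ K.+1 * (#|E|%:R * beta).

(** Small level sets gain by the energy bound; a large one carries so little
    mass per point that its contribution is small whatever [nu] does. *)
Lemma level_part_le (j : 'I_m.+1) : (j < m)%N ->
  \sum_z convolve nu (level_part j) z `^ q <=
  2 `^ q * (2 * theta `^ (r / K.+1%:R) * \sum_z f z `^ q +
            (beta / theta) `^ (q - 1)).
Proof.
move=> jm; pose E := level j; pose f_E (z : G) : R := (z \in E)%:R.
have q0 : 0 < q by apply: lt_trans q1.
have rhs0 : 0 <= 2 `^ q * (2 * theta `^ (r / K.+1%:R) * \sum_z f z `^ q +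
            (beta / theta) `^ (q - 1)).
  rewrite mulr_ge0 ?powR_ge0 // addr_ge0 ?powR_ge0 // !mulr_ge0 ?powR_ge0 //.
  by apply: sumr_ge0 => z _; exact: powR_ge0.
have f_E0 z : 0 <= f_E z by exact: ler0n.
have f_E1 z : f_E z <= 1 by rewrite /f_E; case: (z \in E).
have -> : \sum_z convolve nu (level_part j) z `^ q =
    (2 ^- j) `^ q * \sum_z convolve nu f_E z `^ q.
  rewrite mulr_sumr; apply: eq_bigr => z _.
  rewrite -powRM ?convolve_ge0 ?invr_ge0 ?exprn_ge0 //; congr (_ `^ _).
  rewrite mulr_sumr; apply: eq_bigr => x _.
  by rewrite /level_part jm mulrCA.
have [/eqP|E0] := posnP #|E|.
  rewrite cards_eq0 => /eqP Ez; rewrite big1 ?mulr0 // => z _.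
  rewrite [convolve _ _ _]big1 ?powR0 ?gt_eqF // => x _.
  by rewrite /f_E Ez inE mulr0.
have E0R : 0 < #|E|%:R :> R by rewrite ltr0n.
have sum_fE : \sum_z f_E z = #|E|%:R by exact: sum_indicator.
have g01 z : 0 <= convolve nu f_E z <= 1 by rewrite convolve_ge0 ?convolve_le.
pose u : R := 2 ^- j.
have u0 : 0 < u by rewrite invr_gt0 exprn_gt0.
have uE z : z \in E -> u <= 2 * f z.
  rewrite inE /u => /andP[+ _]; rewrite exprS invfM.
  by rewrite -(ltr_pM2l (ltr0n R 2)) mulVKf // => /ltW.
have [small|large] := leP (#|E|%:R * beta) theta.
  have Ef : u `^ q * #|E|%:R <= 2 `^ q * \sum_z f z `^ q.
    rewrite mulr_sumr (bigID (fun z => z \in E)) /= -[leLHS]addr0 lerD //.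
      rewrite mulr_natr -sumr_const; apply: ler_sum => z zE.
      rewrite -powRM // ge0_ler_powR ?nnegrE ?(ltW q0) ?(ltW u0) ?uE //.
      by apply: mulr_ge0; [exact: ler0n|exact: f0].
    by apply: sumr_ge0 => z _; rewrite mulr_ge0 ?powR_ge0.
  have tau0 : 0 < theta `^ K.+1%:R^-1 by rewrite powR_gt0.
  set tau := theta `^ K.+1%:R^-1 in tau0.
  have en : energy (convolve nu f_E) <= tau * #|E|%:R.
    rewrite -(@ler_pXn2r _ K.+1) ?nnegrE //; last 2 first.
    - by apply: sumr_ge0 => z _; exact: sqr_ge0.
    - by rewrite mulr_ge0 ?ltW.
    apply: (le_trans (energyE E0)); rewrite exprMn mulrC ler_wpM2r ?exprn_ge0 //.
    by rewrite -powR_mulrn ?(ltW tau0) // -powRrM mulVf // powRr1 // ltW.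
  have gq : \sum_z convolve nu f_E z `^ q <= 2 * tau `^ r * #|E|%:R.
    apply: (@le_trans _ _ (\sum_z (tau `^ r * convolve nu f_E z +
        tau `^ (r - 1) * convolve nu f_E z ^+ 2))).
      by apply: ler_sum => z _; apply: powR_split_le.
    rewrite big_split /= -!mulr_sumr sum_convolve // sum_fE.
    have : tau `^ (r - 1) * energy (convolve nu f_E) <= tau `^ r * #|E|%:R.
      have -> : tau `^ r = tau `^ (r - 1) * tau.
        by rewrite -{3}(powRr1 (ltW tau0)) -powRD ?(gt_eqF tau0) ?implybT // subrK.
      by rewrite -mulrA ler_wpM2l ?powR_ge0.
    by rewrite /energy; lra.
  have tauE : tau `^ r = theta `^ (r / K.+1%:R).
    by rewrite /tau -powRrM mulrC.
  apply: (le_trans (ler_wpM2l (powR_ge0 _ _) gq)); rewrite -tauE -/u.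
  have : 2 * tau `^ r * (u `^ q * #|E|%:R) <= 2 * tau `^ r * (2 `^ q * \sum_z f z `^ q).
    by rewrite ler_wpM2l // mulr_ge0 ?powR_ge0.
  have : 0 <= 2 `^ q * (beta / theta) `^ (q - 1) by rewrite mulr_ge0 ?powR_ge0.
  by lra.
have uE2 : u * #|E|%:R <= 2.
  have -> : 2 = 2 * \sum_z f z :> R by rewrite f1 mulr1.
  rewrite mulr_sumr (bigID (fun z => z \in E)) /= -[leLHS]addr0 lerD //.
    by rewrite mulr_natr -sumr_const; apply: ler_sum => z; exact: uE.
  by apply: sumr_ge0 => z _; rewrite mulr_ge0.
have bt : u <= 2 * (beta / theta).
  have : u * theta <= u * (#|E|%:R * beta) by rewrite ler_wpM2l ?ltW.
  rewrite mulrA [2 * _]mulrA ler_pdivlMr // => h; apply: (le_trans h).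
  by rewrite ler_wpM2r ?(ltW beta0).
have g_le : \sum_z convolve nu f_E z `^ q <= #|E|%:R.
  rewrite -sum_fE -(sum_convolve nu1 f_E); apply: ler_sum => z _.
  have /andP[g0 g1] := g01 z.
  have [->|gn0] := eqVneq (convolve nu f_E z) 0; first by rewrite powR0 ?gt_eqF.
  by rewrite -[leRHS]powRr1 // ger_powR ?lt0r ?gn0 ?g0 // ltW.
apply: (le_trans (ler_wpM2l (powR_ge0 _ _) g_le)); rewrite -/u.
have -> : u `^ q * #|E|%:R = u `^ (q - 1) * (u * #|E|%:R).
  rewrite mulrA; congr (_ * _).
  by rewrite -{3}(powRr1 (ltW u0)) -powRD ?(gt_eqF u0) ?implybT // subrK.
have bt0 : 0 <= beta / theta by rewrite divr_ge0 ?ltW.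
apply: (@le_trans _ _ ((2 * (beta / theta)) `^ (q - 1) * 2)).
  rewrite ler_pM ?powR_ge0 ?mulr_ge0 ?(ltW u0) //.
  have q10 : 0 <= q - 1 by rewrite subr_ge0 ltW.
  apply: ge0_ler_powR => //; rewrite nnegrE ?(ltW u0) //.
  exact: (mulr_ge0 (ler0n R 2) bt0).
rewrite powRM // mulrAC.
have -> : 2 `^ (q - 1) * 2 = 2 `^ q :> R.
  by rewrite -{2}(powRr1 (ler0n R 2)) -powRD ?subrK ?pnatr_eq0 ?implybT.
rewrite ler_wpM2l ?powR_ge0 // lerDr !mulr_ge0 ?powR_ge0 //.
by apply: sumr_ge0 => z _; exact: powR_ge0.
Qed.

Lemma convolve_Lq_le :
  \sum_z convolve nu f z `^ q <=
  m.+1%:R `^ q * (m%:R * (2 `^ q * (2 * theta `^ (r / K.+1%:R) *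
    \sum_z f z `^ q + (beta / theta) `^ (q - 1))) + (2 ^- m) `^ (q - 1)).
Proof.
apply: (le_trans convolve_level_sum_le); rewrite ler_wpM2l ?powR_ge0 //.
rewrite big_ord_recr /= lerD ?tail_part_le //.
rewrite -[m in leRHS]card_ord mulr_natl -sumr_const; apply: ler_sum => j _.
by apply: level_part_le; rewrite /= ltn_ord.
Qed.

End LevelSets.

(** * The discrete improvement estimate *)

(** The threshold [theta = 2 `^ (- d * m)] decides which level sets count as
    small; the gain [theta `^ (r / K.+1)] on these is [2 `^ (- kappa * m)]. *)
Lemma discrete_Lq_improvement (R : realType) (q d : R) (H : nat) :
  1 < q -> 0 < d ->
  exists (ell : nat) (kappa C : R), [/\ (0 < ell)%N, 0 < kappa, 0 < C &
  forall (L : nat) (nu f : 'I_L.+1 -> R) (m n : nat),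
    (forall x, 0 <= nu x) -> \sum_x nu x = 1 ->
    (forall x, 0 <= f x) -> \sum_x f x = 1 ->
    (forall j, (j < n)%N -> scale_perfect nu H (2 ^ (ell * j.+1))) ->
  \sum_z convolve nu f z `^ q <= C * m.+1%:R `^ (q + 1) *
    (2 `^ (- (kappa * m%:R)) * (\sum_z f z `^ q) +
     2 `^ ((q - 1) * (d * m%:R + (d - 1) * (ell * n)%:R)) +
     2 `^ (- ((q - 1) * m%:R)))].
Proof.
move=> q1 d0; have [ell [K [ell0 energyE]]] := energy_indicator_perfect_le H d0.
have K0 : 0 < K.+1%:R :> R by rewrite ltr0n.
pose r := Num.min 1 (q - 1).
have r01 : 0 < r <= 1 by rewrite /r lt_min ltr01 subr_gt0 q1 ge_min lexx.
have rq : 1 + r <= q.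
  have : r <= q - 1 by rewrite /r ge_min lexx orbT.
  by lra.
have [r0 _] := andP r01.
exists ell, (d * r / K.+1%:R), (2 `^ q * (2 + K.+1%:R `^ (q - 1))).
split=> //.
- by rewrite divr_gt0 // mulr_gt0.
move=> L nu f m n nu0 nu1 f0 f1 perf.
pose beta : R := K.+1%:R * 2 `^ ((d - 1) * (ell * n)%:R).
pose theta : R := 2 `^ (- (d * m%:R)).
have beta0 : 0 < beta by rewrite mulr_gt0 ?powR_gt0.
have theta0 : 0 < theta by rewrite powR_gt0.
have two0 : (2 : R) != 0 by rewrite pnatr_eq0.
apply: (le_trans (convolve_Lq_le m q1 nu0 nu1 f0 f1 beta0 theta0 r01 rq
  (energyE L nu n nu0 nu1 perf))).
have -> : theta `^ (r / K.+1%:R) = 2 `^ (- (d * r / K.+1%:R * m%:R)).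
  by rewrite /theta -powRrM; congr (2 `^ _); ring.
have -> : (beta / theta) `^ (q - 1) = K.+1%:R `^ (q - 1) *
    2 `^ ((q - 1) * (d * m%:R + (d - 1) * (ell * n)%:R)).
  rewrite /beta /theta -powRN opprK -mulrA -powRD ?two0 ?implybT //.
  rewrite powRM ?powR_ge0 // -powRrM; congr (_ * 2 `^ _); ring.
have -> : (2 ^- m) `^ (q - 1) = 2 `^ (- ((q - 1) * m%:R)) :> R.
  by rewrite -powR_invn // -powRrM; congr (2 `^ _); ring.
set S := \sum_z f z `^ q; set X := 2 `^ (- (d * _ / _ * _)).
set Y := 2 `^ ((q - 1) * _); set Z := 2 `^ (- ((q - 1) * _)).
have S0 : 0 <= S by apply: sumr_ge0 => z _; exact: powR_ge0.
have X0 : 0 <= X by exact: powR_ge0.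
have Y0 : 0 <= Y by exact: powR_ge0.
have Z0 : 0 <= Z by exact: powR_ge0.
set k := K.+1%:R `^ (q - 1); have k0 : 0 <= k by exact: powR_ge0.
have t1 : 1 <= 2 `^ q :> R.
  by rewrite -[leLHS](powRr0 2) ler_powR ?ler1n // ltW // (lt_trans ltr01).
rewrite [m.+1%:R `^ (q + 1)]powRD ?pnatr_eq0 ?implybT // powRr1 //.
set p := m.+1%:R `^ q; have p0 : 0 <= p by exact: powR_ge0.
set W := X * S + Y + Z; set c := 2 `^ q in t1 *.
have XS0 : 0 <= X * S by exact: mulr_ge0.
have W0 : 0 <= W by rewrite /W !addr_ge0.
have -> : c * (2 + k) * (p * m.+1%:R) * W = p * (c * (2 + k) * m.+1%:R * W) by ring.
rewrite ler_wpM2l //.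
have part : c * (2 * X * S + k * Y) <= c * ((2 + k) * W).
  have kXSZ : 0 <= k * (X * S + Z) by rewrite mulr_ge0 ?addr_ge0.
  by rewrite ler_wpM2l ?(le_trans ler01) // /W; lra.
have ZcW : Z <= c * ((2 + k) * W).
  have ZW : Z <= (2 + k) * W.
    by rewrite mulrDl ler_wpDr ?mulr_ge0 // /W; lra.
  apply: (le_trans ZW); rewrite ler_peMl // mulr_ge0 // addr_ge0 //.
have m0 : 0 <= m%:R :> R by [].
by have := ler_wpM2l m0 part; rewrite -natr1; lra.
Qed.

(** * Supports of Borel probabilities on the line *)

Section Support.
Variables (R : realType) (nu : borel_probability R).

(** The complement of the support is covered by countably many null balls, with
    rational centres and radii [1 / k.+1]. *)
Lemma null_off_support (A : set R) : measurable (A : set (measurableTypeR R)) ->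
  A `<=` ~` spt nu -> nu A = 0%E.
Proof.
move=> mA Aspt.
pose b (u : rat * nat) : set R := ball (ratr u.1 : R) (u.2.+1%:R^-1).
pose F (i : nat) : set (measurableTypeR R) :=
  if unpickle i is Some u then if nu (b u) == 0%E then b u else set0 else set0.
have mb u : measurable (b u : set (measurableTypeR R)).
  by rewrite /b ball_itv; exact: measurable_itv.
have mF i : measurable (F i).
  rewrite /F; case: (unpickle i) => [u|//]; by case: ifP.
have F0 i : nu (F i) = 0%E.
  rewrite /F; case: (unpickle i) => [u|]; last exact: measure0.
  by case: eqP => // _; exact: measure0.
have AF : A `<=` \bigcup_i F i.
  move=> x /Aspt; rewrite /spt /= => /existsNP[r] /not_implyP[r0 /negP].
  rewrite -leNgt => nu_le0.
  have [k [e [ke e0 kr]]] : exists k : nat, exists e : R,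
      [/\ e = k.+1%:R^-1, 0 < e & e < r / 2].
    exists (Num.truncn (2 / r)), (Num.truncn (2 / r)).+1%:R^-1.
    split=> //; rewrite invf_plt ?posrE ?divr_gt0 //.
    by rewrite invf_div; exact: truncnS_gt.
  have [a] : exists a : rat, ratr a \in `]x - e, x + e[.
    by apply: rat_in_itvoo; lra.
  rewrite in_itv /= => /andP[ax xa].
  have bsub : b (a, k) `<=` ball x r.
    rewrite /b -ke !ball_itv => y /=; rewrite !in_itv /= => /andP[h1 h2].
    by apply/andP; split; lra.
  have [i iak] : exists i, unpickle i = Some (a, k).
    by exists (pickle (a, k)); exact: pickleK.
  exists i => //; rewrite /F iak.
  rewrite ifT; last first.
    rewrite -measure_le0; apply: le_trans nu_le0.
    apply: le_measure; rewrite ?inE //.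
    by rewrite ball_itv; exact: measurable_itv.
  by rewrite /b -ke ball_itv /= in_itv /=; apply/andP; split; lra.
apply/eqP; rewrite -measure_le0.
have h := @measure_sigma_subadditive _ _ _ nu A F mF mA AF.
apply: (le_trans h).
by rewrite eseries0 // => i _ _; exact: F0.
Qed.

Lemma compact_support_bounded : compactly_supported nu ->
  exists B : nat, nu (~` `[- B%:R, B%:R[%classic) = 0%E.
Proof.
move=> /compact_bounded [M [_ hM]].
pose B := (Num.truncn (`|M| + 1)).+1.
exists B; apply: null_off_support.
  by apply: measurableC; exact: measurable_itv.
move=> x /= xB xs; apply: xB; rewrite in_itv /=.
have : `|x| <= `|M| + 1.
  by apply: (hM (`|M| + 1)) => //; rewrite (le_lt_trans (ler_norm M)) // ltrDl.
have : `|M| + 1 < B%:R by exact: truncnS_gt.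
move=> h1 h2; have := le_lt_trans h2 h1.
by rewrite ltr_norml => /andP[h3 h4]; rewrite h4 ltW.
Qed.

End Support.

(** * Masses of dyadic grid cells *)

Section GridMasses.
Variables (R : realType) (nu : borel_probability R) (m B : nat).

(** The origin is moved to [- B], so that the cells meeting [[-B, B[] are indexed
    by natural numbers. *)
Definition grid_cell (x : nat) : set R :=
  `[x%:R / 2 ^+ m - B%:R, x.+1%:R / 2 ^+ m - B%:R[%classic.

Definition grid_mass (x : nat) : R := fine (nu (grid_cell x)).

Let m0 : 0 < 2 ^+ m :> R. Proof. exact: exprn_gt0. Qed.

Lemma grid_cellE x t : grid_cell x t <-> (x%:R <= (t + B%:R) * 2 ^+ m < x.+1%:R).
Proof.
rewrite /grid_cell /= in_itv /= lerBlDr ler_pdivrMr // ltrBrDr ltr_pdivlMr //.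
Qed.

Lemma measurable_grid_cell x : measurable (grid_cell x : set (measurableTypeR R)).
Proof. exact: measurable_itv. Qed.

Lemma grid_index t : - B%:R <= t -> exists x, grid_cell x t.
Proof.
move=> Bt; exists (Num.truncn ((t + B%:R) * 2 ^+ m)); apply/grid_cellE.
by apply: truncn_itv; rewrite mulr_ge0 ?(ltW m0) // -lerBlDr sub0r.
Qed.

Lemma grid_cell_inj x y t : grid_cell x t -> grid_cell y t -> x = y.
Proof.
by move=> /grid_cellE /truncn_def <- /grid_cellE /truncn_def <-.
Qed.

Lemma grid_massE x : nu (grid_cell x) = (grid_mass x)%:E.
Proof. by rewrite fineK // fin_num_measure //; exact: measurable_grid_cell. Qed.

Lemma grid_mass_ge0 x : 0 <= grid_mass x.
Proof. by apply: fine_ge0. Qed.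

Lemma sum_grid_massE N (P : pred 'I_N) :
  (\sum_(x < N | P x) grid_mass x)%:E =
  nu (\big[setU/set0]_(x < N) if P x then grid_cell x else set0).
Proof.
have mF (x : 'I_N) : measurable
    ((if P x then grid_cell x else set0) : set (measurableTypeR R)).
  by case: (P x) => //; exact: measurable_grid_cell.
rewrite (@measure_semi_additive_ord _ _ _ nu N
  (fun x : 'I_N => if P x then grid_cell x else set0)) //; last 2 first.
- apply/trivIsetP => x y _ _ xy; rewrite -subset0 => t [].
  case: (P x) => //; case: (P y) => // tx ty.
  by move: xy; rewrite (_ : x = y) ?eqxx //; apply/val_inj/(grid_cell_inj tx ty).
- by apply: bigsetU_measurable => x _; exact: mF.
rewrite big_mkcond /= -sumEFin; apply: eq_bigr => x _.
by case: (P x); rewrite ?measure0 // grid_massE.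
Qed.

Lemma mem_grid_union N (P : pred 'I_N) t :
  (\big[setU/set0]_(x < N) if P x then grid_cell x else set0) t <->
  exists2 x : 'I_N, P x & grid_cell x t.
Proof.
rewrite -bigcup_seq; split=> [[x _]|[x Px xt]].
  by case: ifP => // Px xt; exists x.
by exists x; [exact: mem_index_enum|rewrite Px].
Qed.

Lemma measurable_grid_union N (P : pred 'I_N) : measurable
  (\big[setU/set0]_(x < N) (if P x then grid_cell x else set0) :
    set (measurableTypeR R)).
Proof.
apply: bigsetU_measurable => x _; case: (P x) => //.
exact: measurable_grid_cell.
Qed.

Lemma sum_grid_mass_le N (P : pred 'I_N) (A : set R) :
  measurable (A : set (measurableTypeR R)) ->
  (forall x, P x -> grid_cell x `<=` A) ->
  ((\sum_(x < N | P x) grid_mass x)%:E <= nu A)%E.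
Proof.
move=> mA PA; rewrite sum_grid_massE; apply: le_measure; rewrite ?inE //.
  exact: measurable_grid_union.
by move=> t /mem_grid_union[x Px]; exact: PA.
Qed.

Lemma le_sum_grid_mass N (P : pred 'I_N) (A D : set R) :
  measurable (A : set (measurableTypeR R)) ->
  measurable (D : set (measurableTypeR R)) -> nu (~` D) = 0%E ->
  (forall t, A t -> D t -> exists2 x : 'I_N, P x & grid_cell x t) ->
  (nu A <= (\sum_(x < N | P x) grid_mass x)%:E)%E.
Proof.
move=> mA mD D0 AP; rewrite sum_grid_massE.
have mU := measurable_grid_union P; set U := \big[_/_]_(_ < _) _ in mU *.
apply: (@le_trans _ _ (nu (U `|` ~` D))).
  apply: le_measure; rewrite ?inE //.
    by apply: measurableU => //; exact: measurableC.
  move=> t At; have [Dt|nDt] := pselect (D t); last by right.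
  by left; apply/mem_grid_union; exact: AP.
apply: (@le_trans _ _ (nu U + nu (~` D))%E); last by rewrite D0 adde0.
by apply: measureU2 => //; exact: measurableC.
Qed.

End GridMasses.

(** * Dyadic sums as finite sums *)

Section DyadicSum.
Variables (R : realType) (nu : borel_probability R) (m B N : nat).

Let m0 : 0 < 2 ^+ m :> R. Proof. exact: exprn_gt0. Qed.

Definition dyadic_cell (k : int) : set R :=
  `[k%:~R * 2 ^- m, (k + 1)%:~R * 2 ^- m[%classic.

Lemma dyadic_cellE k t :
  dyadic_cell k t <-> (k%:~R <= t * 2 ^+ m < (k + 1)%:~R).
Proof. by rewrite /dyadic_cell /= in_itv /= ler_pdivrMr // ltr_pdivlMr. Qed.

Lemma dyadic_cell_inj k l t : dyadic_cell k t -> dyadic_cell l t -> k = l.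
Proof.
move=> /dyadic_cellE /andP[h1 h2] /dyadic_cellE /andP[h3 h4].
have := le_lt_trans h1 h4; have := le_lt_trans h3 h2.
by rewrite !ltr_int; lia.
Qed.

Lemma grid_dyadic_cell x :
  @grid_cell R m B x = dyadic_cell (x%:Z - (B * 2 ^ m)%:Z).
Proof.
apply/seteqP; split=> t.
  move/grid_cellE => h; apply/dyadic_cellE; move: h.
  rewrite !intrD !intrN -!pmulrn natrM natrX mulrDl -natr1.
  by move=> /andP[h1 h2]; apply/andP; split; lra.
move/dyadic_cellE => h; apply/grid_cellE; move: h.
rewrite !intrD !intrN -!pmulrn natrM natrX mulrDl -natr1.
by move=> /andP[h1 h2]; apply/andP; split; lra.
Qed.

Lemma grid_cell_nonempty x : @grid_cell R m B x !=set0.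
Proof.
exists (x%:R / 2 ^+ m - B%:R); apply/grid_cellE.
by rewrite subrK divfK ?gt_eqF // lexx ltr_nat ltnSn.
Qed.

(** Dyadic intervals other than the first [N] grid cells avoid [D], so they are
    null and contribute nothing. *)
Lemma esum_dyadicE (D : set R) (q : R) : 0 < q ->
  measurable (D : set (measurableTypeR R)) -> nu (~` D) = 0%E ->
  (forall t, D t -> exists2 x, (x < N)%N & @grid_cell R m B x t) ->
  (\esum_(Q in @dyadic R m) (nu Q `^ q))%E =
  (\sum_(x < N) grid_mass nu m B x `^ q)%:E.
Proof.
move=> q0 mD D0 DN; pose g (x : 'I_N) : set R := @grid_cell R m B x.
pose r := index_enum 'I_N.
have inj_g : {in [set` r] &, injective g}.
  move=> x y _ _ xy; have [t xt] := grid_cell_nonempty x.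
  apply/val_inj/(grid_cell_inj xt); rewrite -/(g y) -xy; exact: xt.
rewrite (esumID (g @` [set` r])) => [|Q _]; last exact: poweR_ge0.
rewrite [X in (_ + X)%E]esum1 ?adde0; last first.
  move=> _ [[k ->] Qg]; rewrite -/(dyadic_cell k).
  have mk : measurable (dyadic_cell k : set (measurableTypeR R)).
    exact: measurable_itv.
  suff -> : nu (dyadic_cell k) = 0%E by rewrite poweR0r // gt_eqF.
  apply/eqP; rewrite -measure_le0 -D0; apply: le_measure; rewrite ?inE //.
    exact: measurableC.
  move=> t kt Dt; apply: Qg; have [x xN xt] := DN t Dt.
  exists (Ordinal xN); first exact: mem_index_enum.
  rewrite /g /= grid_dyadic_cell; congr dyadic_cell.
  by apply: (dyadic_cell_inj _ kt); rewrite -grid_dyadic_cell.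
have -> : dyadic m `&` g @` [set` r] = g @` [set` r].
  apply: setIidr => _ [x _ <-]; rewrite /g grid_dyadic_cell.
  by exists (x%:Z - (B * 2 ^ m)%:Z).
rewrite esum_image // esum_fset //; last by move=> i _; exact: poweR_ge0.
rewrite -fsbig_seq ?index_enum_uniq // -sumEFin; apply: eq_bigr => x _.
by rewrite /g grid_massE poweR_EFin.
Qed.

End DyadicSum.

(** * Uniform perfectness on the grid *)

Section UniformlyPerfectGrid.
Variables (R : realType) (nu : borel_probability R) (N gamma : R).
Hypothesis perf : uniformly_perfect N gamma nu.

Let ball_mass (x r : R) : R := fine (nu (ball x r)).

Let measurable_ballR (x r : R) : measurable (ball x r : set (measurableTypeR R)).
Proof. by rewrite ball_itv; exact: measurable_itv. Qed.

Let ball_massE (x r : R) : nu (ball x r) = (ball_mass x r)%:E.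
Proof. by rewrite fineK // fin_num_measure //; exact: measurable_ballR. Qed.

Lemma ball_mass_iter (x r : R) (j : nat) : 0 < r ->
  ~ (spt nu `<=` ball x (N ^+ j * r)) ->
  (2 `^ gamma) ^+ j * ball_mass x r <= ball_mass x (N ^+ j * r).
Proof.
move=> r0; have [N1 _ growth] := perf.
have N0 : 0 < N by apply: lt_trans N1.
elim: j => [|j IH] nsub; first by rewrite !expr0 !mul1r.
have Nr : 0 < N ^+ j * r by rewrite mulr_gt0 // exprn_gt0.
have jsub : ~ (spt nu `<=` ball x (N ^+ j * r)).
  move=> sub; apply: nsub; apply: (subset_trans sub); apply: le_ball.
  by rewrite ler_wpM2r ?(ltW r0) // ler_eXn2l.
rewrite !exprS -!mulrA.
apply: (@le_trans _ _ (2 `^ gamma * ball_mass x (N ^+ j * r))).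
  by rewrite ler_wpM2l ?powR_ge0 // IH.
have := growth x _ Nr; rewrite !ball_massE -EFinM lee_fin; apply.
by move: nsub; rewrite exprS -mulrA.
Qed.

(** After this many dilations by [N] the mass of a ball has at least doubled. *)
Definition perfect_steps : nat := (Num.truncn gamma^-1).+1.

(** A dilated ball of initial radius two cell lengths reaches no further than
    this number of cells from its centre. *)
Definition perfect_width : nat := (Num.truncn (2 * N ^+ perfect_steps + 1)).+1.

Let J := perfect_steps.
Let H := perfect_width.

Lemma doubling_of_steps : 2 <= (2 `^ gamma) ^+ J.
Proof.
have [_ /andP[g0 _] _] := perf.
rewrite -powR_mulrn ?powR_ge0 // -powRrM -[leLHS]powRr1 //.
rewrite ler_powR ?ler1n // mulrC -ler_pdivrMr // div1r.
exact: ltW (truncnS_gt _).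
Qed.

Lemma coarse_cell (m B e y : nat) (t : R) : @grid_cell R m B y t ->
  (y %/ 2 ^ e)%:R <= (t + B%:R) / (2 ^+ e / 2 ^+ m) < (y %/ 2 ^ e).+1%:R.
Proof.
move/grid_cellE => /andP[yt ty]; have e0 : 0 < 2 ^+ e :> R by exact: exprn_gt0.
have m0 : 0 < 2 ^+ m :> R by exact: exprn_gt0.
have -> : (t + B%:R) / (2 ^+ e / 2 ^+ m) = (t + B%:R) * 2 ^+ m / 2 ^+ e.
  by field; rewrite !gt_eqF.
rewrite ler_pdivlMr // ltr_pdivrMr // -natrX -!natrM; apply/andP; split.
  by apply: le_trans yt; rewrite ler_nat leq_trunc_div.
by apply: (lt_le_trans ty); rewrite ler_nat; rewrite ltn_ceil ?expn_gt0.
Qed.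

(** A cell and its two neighbours lie in a ball of radius twice the cell length.
    The hypothesis on [|a - b|] prevents the dilated balls from containing both
    support points [a] and [b], so that each dilation increases the mass. *)
Lemma scale_perfect_grid (B m e L : nat) (a b : R) :
  nu (~` `[- B%:R, B%:R[%classic) = 0%E -> (2 * B * 2 ^ m <= L)%N ->
  spt nu a -> spt nu b -> 4 * N ^+ J * (2 ^+ e / 2 ^+ m) <= `|a - b| ->
  scale_perfect (fun x : 'I_L.+1 => grid_mass nu m B x) H (2 ^ e).
Proof.
move=> B0 LB sa sb hab x _; have [N1 _ _] := perf.
have N0 : 0 < N by apply: lt_trans N1.
have J1 : 1 <= N ^+ J by rewrite exprn_ege1 // ltW.
have e0 : 0 < 2 ^+ e :> R by exact: exprn_gt0.
have m0 : 0 < 2 ^+ m :> R by exact: exprn_gt0.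
pose h : R := 2 ^+ e / 2 ^+ m; have h0 : 0 < h by rewrite divr_gt0.
pose c := cell (2 ^ e) x.
pose y0 : R := (c%:R + 1 / 2) * h - B%:R.
have centered t : t - y0 = ((t + B%:R) / h - (c%:R + 1 / 2)) * h.
  by rewrite /y0; field; rewrite gt_eqF.
have Hge : 2 * N ^+ J + 1 < H%:R by exact: truncnS_gt.
have in_ball k t : ball y0 (k * h) t <->
    (c%:R + 1 / 2 - k < (t + B%:R) / h < c%:R + 1 / 2 + k).
  rewrite ball_itv /= in_itv /=.
  have := centered t; set s := (t + B%:R) / h => ct.
  split=> /andP[h1 h2]; apply/andP.
    by split; rewrite -(ltr_pM2r h0); lra.
  move: h1 h2; rewrite -(ltr_pM2r h0) => h1; rewrite -(ltr_pM2r h0) => h2.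
  by split; lra.
have near1 : \sum_(y < L.+1 | near_cells (2 ^ e) 1 x y) grid_mass nu m B y <=
    ball_mass y0 (2 * h).
  rewrite -lee_fin -ball_massE; apply: sum_grid_mass_le => // y.
  rewrite /near_cells -/c -!(ler_nat R) !natrD => /andP[yc cy] t.
  move=> /(coarse_cell e); rewrite -/h -/(cell (2 ^ e) y) -natr1 => /andP[yt ty].
  by apply/in_ball; apply/andP; split; lra.
have nearH : ball_mass y0 (N ^+ J * (2 * h)) <=
    \sum_(y < L.+1 | near_cells (2 ^ e) H x y) grid_mass nu m B y.
  rewrite -lee_fin -ball_massE.
  have mD : measurable (`[- B%:R, B%:R[%classic : set (measurableTypeR R)).
    exact: measurable_itv.
  apply: (le_sum_grid_mass (measurable_ballR _ _) mD B0) => t.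
  rewrite mulrA => /in_ball /andP[t1 t2].
  rewrite /= in_itv /= => /andP[Bt tB]; have [y yt] := grid_index m Bt.
  have yL : (y < L.+1)%N.
    have /grid_cellE /andP[h1 _] := yt.
    rewrite ltnS; apply: leq_trans LB; rewrite -(ler_nat R); apply: (le_trans h1).
    rewrite !natrM natrX ler_wpM2r ?(ltW m0) //; lra.
  exists (Ordinal yL) => //; have /(coarse_cell e) /= := yt.
  rewrite -/h -natr1 => /andP[h1 h2].
  rewrite /near_cells -/c /cell /= -!(ler_nat R) !natrD.
  by apply/andP; split; lra.
have nsub : ~ (spt nu `<=` ball y0 (N ^+ J * (2 * h))).
  move=> sub; have := sub _ sa; have := sub _ sb; rewrite mulrA.
  move=> /in_ball bb /in_ball aa.
  have : `|a - b| < 4 * N ^+ J * h.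
    have -> : a - b = ((a + B%:R) / h - (b + B%:R) / h) * h.
      by field; rewrite gt_eqF.
    rewrite normrM (gtr0_norm h0) ltr_pM2r // ltr_norml.
    by move: aa bb => /andP[? ?] /andP[? ?]; apply/andP; split; lra.
  by rewrite ltNge hab.
have bm0 : 0 <= ball_mass y0 (2 * h) by apply: fine_ge0.
have h20 : 0 < 2 * h by rewrite mulr_gt0.
apply: le_trans nearH; apply: le_trans (ball_mass_iter h20 nsub).
apply: (@le_trans _ _ (2 * ball_mass y0 (2 * h))); first by rewrite ler_wpM2l.
by rewrite ler_wpM2r // doubling_of_steps.
Qed.

End UniformlyPerfectGrid.

(** * Convolution on the grid *)

Lemma measure_bigU_le d (T : measurableType d) (R : realType)
    (P : {measure set T -> \bar R}) (I : Type) (r : seq I) (F : I -> set T) :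
  (forall i, measurable (F i)) ->
  (P (\big[setU/set0]_(i <- r) F i) <= \sum_(i <- r) P (F i))%E.
Proof.
move=> mF; elim: r => [|i r IH]; first by rewrite !big_nil measure0.
rewrite !big_cons; apply: le_trans (leeD2l _ IH).
by apply: measureU2 => //; apply: bigsetU_measurable.
Qed.

(** The cyclic group of order [4 * B * 2 ^ m + 1] is large enough for the sum of
    the indices of two cells meeting [[-B, B[] not to wrap around. *)
Definition grid_law (R : realType) (B : nat) (rho : borel_probability R)
    (m : nat) : 'I_(4 * B * 2 ^ m).+1 -> R := fun x => grid_mass rho m B x.
Arguments grid_law {R} B rho m x.

Section ConvolutionGrid.
Variables (R : realType) (mu nu : borel_probability R) (B : nat).
Let D : set R := `[- B%:R, B%:R[%classic.
Hypotheses (muD : mu (~` D) = 0%E) (nuD : nu (~` D) = 0%E).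

Let P := (mu \x nu)%E.
Let T2 : Type := (measurableTypeR R * measurableTypeR R)%type.

Let mD : measurable (D : set (measurableTypeR R)).
Proof. exact: measurable_itv. Qed.

Let bad : set T2 := (~` D) `*` setT `|` setT `*` (~` D).

Let measurable_bad : measurable bad.
Proof. by apply: measurableU; apply: measurableX => //; exact: measurableC. Qed.

Let bad_null : P bad = 0%E.
Proof.
apply/eqP; rewrite -measure_le0.
apply: (@le_trans _ _ (P ((~` D) `*` setT) + P (setT `*` (~` D)))%E).
  by apply: measureU2; apply: measurableX => //; exact: measurableC.
have -> : P ((~` D) `*` setT) = (mu (~` D) * nu setT)%E.
  by apply: product_measure1E => //; exact: measurableC.
have -> : P (setT `*` (~` D)) = (mu setT * nu (~` D))%E.
  by apply: product_measure1E => //; exact: measurableC.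
by rewrite muD nuD mul0e mule0 adde0.
Qed.

Lemma convolutionE (A : set (measurableTypeR R)) :
  convolution mu nu A = P (@Defs.add_pair R @^-1` A).
Proof. by []. Qed.

Lemma measurable_preimage_add (A : set (measurableTypeR R)) :
  measurable A -> measurable (@Defs.add_pair R @^-1` A).
Proof. by move=> mA; rewrite -[_ @^-1` _]setTI; exact: measurable_add_pair. Qed.

Lemma convolution_null :
  convolution mu nu (~` `[- (2 * B)%:R, (2 * B)%:R[%classic) = 0%E.
Proof.
rewrite convolutionE; apply/eqP; rewrite -measure_le0 -bad_null.
apply: le_measure; rewrite ?inE //.
  by apply: measurable_preimage_add; apply: measurableC; exact: measurable_itv.
move=> [s t] st; have [Ds|nDs] := pselect (D s); last by left.
have [Dt|nDt] := pselect (D t); last by right.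
exfalso; apply: st; move: Ds Dt; rewrite /D /Defs.add_pair /= !in_itv /= natrM.
by move=> /andP[h1 h2] /andP[h3 h4]; apply/andP; split; lra.
Qed.

Lemma grid_cell_add m (x y z : nat) (s t : R) :
  @grid_cell R m B y s -> @grid_cell R m B x t ->
  @grid_cell R m (2 * B) z (s + t) -> (z = x + y \/ z = (x + y).+1)%N.
Proof.
move=> /grid_cellE /andP[h1 h2] /grid_cellE /andP[h3 h4].
move=> /grid_cellE /andP[]; rewrite natrM => h5 h6.
have zl : (z < (x + y).+2)%N.
  rewrite -(ltr_nat R) -addn2 !natrD; move: h2 h4.
  by rewrite -[y.+1%:R]natr1 -[x.+1%:R]natr1; lra.
have zu : (x + y < z.+1)%N by rewrite -(ltr_nat R) natrD; lra.
by lia.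
Qed.

(** The sum of a point of cell [y] and a point of cell [x] lies in cell [x + y] or
    in the next one. *)
Lemma grid_mass_convolution_le m (z : 'I_(4 * B * 2 ^ m).+1) :
  grid_mass (convolution mu nu) m (2 * B) z <=
    convolve (grid_law B nu m) (grid_law B mu m) z +
    convolve (grid_law B nu m) (grid_law B mu m) (z - inZp 1).
Proof.
pose G := 'I_(4 * B * 2 ^ m).+1.
pose g := grid_law B nu m; pose f := grid_law B mu m; rewrite -/g -/f.
have m0 : 0 < 2 ^+ m :> R by exact: exprn_gt0.
pose U (x : G) : set (measurableTypeR R) :=
  grid_cell m B ((z - x)%R : G) `|` grid_cell m B ((z - inZp 1 - x)%R : G).
pose F (x : G) : set T2 := U x `*` (grid_cell m B x : set (measurableTypeR R)).
have mU x : measurable (U x) by apply: measurableU; exact: measurable_grid_cell.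
have mF x : measurable (F x) by apply: measurableX => //; exact: measurable_grid_cell.
rewrite -lee_fin -grid_massE convolutionE.
apply: (@le_trans _ _ (P (\big[setU/set0]_(x : G) F x `|` bad))).
  apply: le_measure; rewrite ?inE.
  - by apply: measurable_preimage_add; exact: measurable_grid_cell.
  - by apply: measurableU => //; exact: bigsetU_measurable.
  move=> [s t] st; have [Ds|nDs] := pselect (D s); last by right; left.
  have [Dt|nDt] := pselect (D t); last by right; right.
  left; rewrite -bigcup_seq.
  have idx (u : R) : D u -> exists2 x : nat, (x < 2 * B * 2 ^ m)%N & @grid_cell R m B x u.
    rewrite /D /= in_itv /= => /andP[Bu uB].
    have [x ux] := grid_index m Bu; exists x => //.
    have /grid_cellE /andP[h1 _] := ux.
    rewrite -(ltr_nat R); apply: (le_lt_trans h1).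
    by rewrite !natrM natrX ltr_pM2r //; lra.
  have [y yL sy] := idx s Ds; have [x xL tx] := idx t Dt.
  have xG : (x < (4 * B * 2 ^ m).+1)%N by lia.
  exists (Ordinal xG); first exact: mem_index_enum.
  split=> //=.
  have [zE|zE] := grid_cell_add sy tx st; [left|right].
    suff -> : ((z - Ordinal xG)%R : G) = y :> nat by [].
    have yG : (y < (4 * B * 2 ^ m).+1)%N by lia.
    suff -> : z = Ordinal yG + Ordinal xG by rewrite addrK.
    by apply: ord_inj; rewrite zE /= modn_small; lia.
  suff -> : ((z - inZp 1 - Ordinal xG)%R : G) = y :> nat by [].
  have yG : (y < (4 * B * 2 ^ m).+1)%N by lia.
  suff -> : z = Ordinal yG + Ordinal xG + inZp 1 by rewrite !addrK.
  apply: ord_inj; rewrite zE /= modnDm modn_small; first lia.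
  by lia.
apply: (@le_trans _ _ (P (\big[setU/set0]_(x : G) F x) + P bad)%E).
  by apply: measureU2 => //; exact: bigsetU_measurable.
rewrite bad_null adde0; apply: (le_trans (measure_bigU_le _ _ mF)).
have -> : convolve g f z + convolve g f (z - inZp 1) =
    \sum_x g x * (f (z - x) + f (z - inZp 1 - x)).
  by rewrite /convolve -big_split; apply: eq_bigr => x _; rewrite mulrDr.
rewrite -sumEFin; apply: lee_sum => x _.
rewrite [leLHS](_ : _ = (mu (U x) * nu (grid_cell m B x))%E); last first.
  by apply: product_measure1E => //; exact: measurable_grid_cell.
rewrite grid_massE muleC EFinM lee_wpmul2l // ?lee_fin ?grid_mass_ge0 //.
rewrite EFinD -!grid_massE; apply: measureU2; exact: measurable_grid_cell.
Qed.

End ConvolutionGrid.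

(** * The improvement estimate for measures *)

Section GridLaw.
Variables (R : realType) (rho : borel_probability R) (B : nat).
Hypothesis rhoB : rho (~` `[- B%:R, B%:R[%classic) = 0%E.

Lemma grid_index_bounded m (t : R) : `[- B%:R, B%:R[%classic t ->
  exists2 x, (x < 2 * B * 2 ^ m)%N & @grid_cell R m B x t.
Proof.
rewrite /= in_itv /= => /andP[Bt tB]; have [x tx] := grid_index m Bt.
exists x => //; have /grid_cellE /andP[h _] := tx.
have m0 : 0 < 2 ^+ m :> R by exact: exprn_gt0.
rewrite -(ltr_nat R); apply: (le_lt_trans h).
by rewrite !natrM natrX ltr_pM2r //; lra.
Qed.

Definition dyadic_sum (q : R) (m : nat) : R :=
  fine (\esum_(Q in @dyadic R m) (rho Q `^ q)%E).

Lemma dyadic_sumE q m L : 0 < q -> (2 * B * 2 ^ m <= L)%N ->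
  dyadic_sum q m = \sum_(x < L.+1) grid_mass rho m B x `^ q.
Proof.
move=> q0 BL; rewrite /dyadic_sum.
have mD : measurable (`[- B%:R, B%:R[%classic : set (measurableTypeR R)).
  exact: measurable_itv.
rewrite (esum_dyadicE (N := L.+1) (B := B) q0 mD rhoB) // => t tB.
have [x xB xt] := grid_index_bounded m tB; exists x => //.
by rewrite ltnS ltnW // (leq_trans xB).
Qed.

Lemma sum_grid_mass_eq1 m L : (2 * B * 2 ^ m <= L)%N ->
  \sum_(x < L.+1) grid_mass rho m B x = 1.
Proof.
move=> BL; have mD : measurable (`[- B%:R, B%:R[%classic : set (measurableTypeR R)).
  exact: measurable_itv.
have rho1 : rho setT = 1%:E by exact: probability_setT.
apply/eqP; rewrite eq_le -!lee_fin -!rho1; apply/andP; split.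
  by apply: (sum_grid_mass_le rho (P := xpredT)) => // x _.
apply: (le_sum_grid_mass (P := xpredT) _ mD rhoB) => // t _ tB.
have [x xB xt] := grid_index_bounded m tB.
have xL : (x < L.+1)%N by rewrite ltnS ltnW // (leq_trans xB).
by exists (Ordinal xL).
Qed.

Lemma dyadic_sum_gt0 q m : 0 < q -> 0 < dyadic_sum q m.
Proof.
move=> q0; rewrite (dyadic_sumE q0 (leqnn _)).
have s1 := sum_grid_mass_eq1 (leqnn (2 * B * 2 ^ m)).
rewrite lt0r sumr_ge0 ?andbT => [|x _]; last exact: powR_ge0.
apply/negP; rewrite psumr_eq0 => [/allP h|x _]; last exact: powR_ge0.
move: s1; rewrite big1 => [/eqP|x _]; first by rewrite eq_sym oner_eq0.
have /= := h x (mem_index_enum x); rewrite powR_eq0 (gt_eqF q0) andbT.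
by move/eqP.
Qed.

Lemma dyadic_sum_le1 q m : 1 < q -> dyadic_sum q m <= 1.
Proof.
move=> q1; rewrite (dyadic_sumE _ (leqnn _)) ?(lt_trans ltr01) //.
have s1 := sum_grid_mass_eq1 (leqnn (2 * B * 2 ^ m)).
rewrite -[leRHS]s1; apply: ler_sum => x _.
have g0 := grid_mass_ge0 rho m B x.
have g1 : grid_mass rho m B x <= 1.
  by rewrite -s1 (bigD1 x) //= lerDl sumr_ge0 // => y _; exact: grid_mass_ge0.
have [->|gn0] := eqVneq (grid_mass rho m B x) 0.
  by rewrite powR0 // gt_eqF // (lt_trans ltr01).
by rewrite -[leRHS]powRr1 // ger_powR ?lt0r ?gn0 ?g0 // ltW.
Qed.

End GridLaw.

Lemma dyadic_sum_convolution_le (R : realType) (mu nu : borel_probability R)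
    (B m : nat) (q : R) : 0 < q ->
  mu (~` `[- B%:R, B%:R[%classic) = 0%E ->
  nu (~` `[- B%:R, B%:R[%classic) = 0%E ->
  dyadic_sum (convolution mu nu) q m <=
  2 `^ q * 2 * \sum_z convolve (grid_law B nu m) (grid_law B mu m) z `^ q.
Proof.
move=> q0 muB nuB.
have BL : (2 * (2 * B) * 2 ^ m <= 4 * B * 2 ^ m)%N by lia.
rewrite (dyadic_sumE (convolution_null muB nuB) q0 BL).
set c := convolve _ _.
have c0 z : 0 <= c z by apply: convolve_ge0 => x; exact: grid_mass_ge0.
apply: (@le_trans _ _ (\sum_z 2 `^ q * (c z `^ q + c (z - inZp 1) `^ q))).
  apply: ler_sum => z _.
  pose a (i : 'I_2) := if i == ord0 then c z else c (z - inZp 1).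
  have a0 i : 0 <= a i by rewrite /a; case: ifP.
  have := powR_sum_le q0 a0; rewrite !big_ord_recl !big_ord0 !addr0 /a /=.
  apply: le_trans; rewrite ge0_ler_powR ?nnegrE ?(ltW q0) ?addr_ge0 ?grid_mass_ge0 //.
  exact: grid_mass_convolution_le.
have shift : \sum_z c (z - inZp 1) `^ q = \sum_z c z `^ q.
  exact: (sum_shift (fun z => c z `^ q) (- inZp 1)).
rewrite -mulr_sumr big_split [X in _ * (_ + X)]shift -mulrA.
by rewrite ler_wpM2l ?powR_ge0 // mulr_natl mulr2n.
Qed.

Lemma common_support_bound (R : realType) (mu nu : borel_probability R) :
  compactly_supported mu -> compactly_supported nu ->
  exists2 B : nat, mu (~` `[- B%:R, B%:R[%classic) = 0%E &
    nu (~` `[- B%:R, B%:R[%classic) = 0%E.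
Proof.
move=> /compact_support_bounded[Bm muBm] /compact_support_bounded[Bn nuBn].
have widen (rho : borel_probability R) (b B : nat) : (b <= B)%N ->
    rho (~` `[- b%:R, b%:R[%classic) = 0%E ->
    rho (~` `[- B%:R, B%:R[%classic) = 0%E.
  move=> bB rho0; apply/eqP; rewrite -measure_le0 -rho0.
  apply: le_measure; rewrite ?inE.
  - by apply: measurableC; exact: measurable_itv.
  - by apply: measurableC; exact: measurable_itv.
  apply: subsetC => t /=; rewrite !in_itv /= => /andP[h1 h2].
  have bBR : b%:R <= B%:R :> R by rewrite ler_nat.
  by apply/andP; split; lra.
exists (maxn Bm Bn).
- exact: (widen mu Bm _ (leq_maxl _ _) muBm).
- exact: (widen nu Bn _ (leq_maxr _ _) nuBn).
Qed.

Lemma level_scale_le (m m1 ell j : nat) : (0 < ell)%N ->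
  (j < (m - m1) %/ ell)%N -> (ell * j.+1 + m1 <= m)%N.
Proof.
move=> ell0 jn; have := leq_trunc_div (m - m1) ell.
have : (j.+1 * ell <= (m - m1) %/ ell * ell)%N by rewrite leq_mul2r jn orbT.
have : (0 < j.+1 * ell)%N by rewrite muln_gt0.
rewrite (mulnC ell); set u := (_ %/ _ * _)%N; set v := (_ * _)%N; lia.
Qed.

Lemma level_scale_ge (m m1 ell : nat) : (0 < ell)%N ->
  (m <= ell * ((m - m1) %/ ell) + (m1 + ell))%N.
Proof.
move=> ell0; have := ltn_ceil (m - m1) ell0; rewrite mulSn mulnC.
by set u := (_ * _)%N; lia.
Qed.

(** Lost are the scales coarser than the distance of two support points of [nu],
    and those left over when scales are grouped into blocks of length [ell].  This
    costs the factor [C], which depends on [nu], while [kappa] does not. *)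
Lemma dyadic_sum_improvement (R : realType) (q N gamma d : R) :
  1 < q -> 0 < d -> d < 1 ->
  exists2 kappa : R, 0 < kappa &
  forall nu : borel_probability R,
    compactly_supported nu -> uniformly_perfect N gamma nu ->
    (forall a, spt nu <> [set a]) ->
  forall mu : borel_probability R, compactly_supported mu ->
  exists2 C : R, 0 < C & forall m : nat,
    dyadic_sum (convolution mu nu) q m <= C * m.+1%:R `^ (q + 1) *
    (2 `^ (- (kappa * m%:R)) * dyadic_sum mu q m +
     2 `^ (- ((q - 1) * (1 - 2 * d) * m%:R))).
Proof.
move=> q1 d0 d1; have q0 : 0 < q by apply: lt_trans q1.
have [ell [kappa [C [ell0 kappa0 C0 improve]]]] :=
  discrete_Lq_improvement (perfect_width N gamma) q1 d0.
exists kappa => // nu nu_cpt perf nDirac mu mu_cpt.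
have [B muB nuB] := common_support_bound mu_cpt nu_cpt.
have [a sa] : exists a, spt nu a.
  apply/not_existsP => nospt.
  have nu0 : nu setT = 0%E.
    by apply: null_off_support => // t _; exact: nospt.
  by have := probability_setT nu; rewrite nu0 => /eqP; rewrite eq_sym onee_eq0.
have [b sb ab] : exists2 b, spt nu b & a <> b.
  apply: contra_notP (nDirac a) => h; apply/seteqP; split=> [b sb|b ->] //.
  by apply: contra_notP h => ba; exists b => // e; apply: ba; rewrite -e.
have ab0 : 0 < `|a - b| by rewrite normr_gt0 subr_eq0; apply/eqP.
have [N1 _ _] := perf.
pose NJ := N ^+ perfect_steps gamma.
have NJ0 : 0 < NJ by rewrite exprn_gt0 // (lt_trans ltr01).
(* At scale [2 ^- m1] and below, no dilated ball contains both [a] and [b]. *)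
pose m1 := (Num.truncn (4 * NJ / `|a - b|)).+1.
have m1P : 4 * NJ <= `|a - b| * 2 ^+ m1.
  rewrite -ler_pdivrMl // mulrC; apply: (le_trans (ltW (truncnS_gt _))).
  by rewrite -natrX ler_nat; apply: ltnW; exact: ltn_expl.
pose E := 2 `^ ((q - 1) * (1 - d) * (m1 + ell)%:R).
have E0 : 0 < E by rewrite powR_gt0.
exists (2 `^ q * 2 * (C * (E + 1))).
  by rewrite !mulr_gt0 ?powR_gt0 // addr_gt0.
move=> m; pose n := ((m - m1) %/ ell)%N.
apply: (le_trans (dyadic_sum_convolution_le m q0 muB nuB)).
rewrite -!mulrA ler_wpM2l ?powR_ge0 // ler_wpM2l // !mulrA.
have BL : (2 * B * 2 ^ m <= 4 * B * 2 ^ m)%N by rewrite !leq_mul2r !orbT.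
have scales j : (j < n)%N ->
    scale_perfect (grid_law B nu m) (perfect_width N gamma) (2 ^ (ell * j.+1)).
  move=> jn; apply: (scale_perfect_grid perf nuB BL sa sb).
  have m0 : 0 < 2 ^+ m :> R by exact: exprn_gt0.
  rewrite mulrA ler_pdivrMr //.
  have jm : (ell * j.+1 + m1 <= m)%N.
    exact: level_scale_le ell0 jn.
  apply: (@le_trans _ _ (`|a - b| * 2 ^+ m1 * 2 ^+ (ell * j.+1))).
    by rewrite ler_wpM2r // exprn_ge0.
  by rewrite -mulrA ler_wpM2l // -exprD ler_eXn2l ?ltr1n // addnC.
have law0 (rho : borel_probability R) x : 0 <= grid_law B rho m x.
  exact: grid_mass_ge0.
have := improve _ (grid_law B nu m) (grid_law B mu m) m n (law0 nu)
  (sum_grid_mass_eq1 nuB BL) (law0 mu) (sum_grid_mass_eq1 muB BL) scales.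
move=> h; apply: (le_trans h).
rewrite -(dyadic_sumE muB q0 BL).
set X := 2 `^ (- (kappa * m%:R)) * _; set p := m.+1%:R `^ _.
set Z := 2 `^ (- ((q - 1) * (1 - 2 * d) * m%:R)).
have X0 : 0 <= X by rewrite mulr_ge0 ?powR_ge0 // ltW // (dyadic_sum_gt0 muB).
have Z0 : 0 <= Z by exact: powR_ge0.
have p0 : 0 <= p by exact: powR_ge0.
have two1 : 1 <= 2 :> R by rewrite ler1n.
have ell_n : m%:R - (m1 + ell)%:R <= (ell * n)%:R :> R.
  rewrite lerBlDr -natrD ler_nat.
  exact: level_scale_ge.
have q10 : 0 < q - 1 by rewrite subr_gt0.
have Y_le : 2 `^ ((q - 1) * (d * m%:R + (d - 1) * (ell * n)%:R)) <= E * Z.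
  rewrite /E /Z -powRD ?pnatr_eq0 ?implybT // ler_powR //.
  have : (1 - d) * (m%:R - (m1 + ell)%:R) <= (1 - d) * (ell * n)%:R.
    by rewrite ler_wpM2l // subr_ge0 ltW.
  by move=> h1; have := ler_wpM2l (ltW q10) h1; lra.
have Z_le : 2 `^ (- ((q - 1) * m%:R)) <= Z.
  rewrite /Z ler_powR // lerN2.
  have : 0 <= (q - 1) * (d * m%:R) by rewrite !mulr_ge0 // ltW.
  by lra.
have -> : C * (E + 1) * p * (X + Z) = C * p * ((E + 1) * (X + Z)) by ring.
rewrite ler_wpM2l ?mulr_ge0 ?(ltW C0) //.
have : 0 <= E * X by rewrite mulr_ge0 // ltW.
by lra.
Qed.

(** * Lower limits and the main theorem *)

Section LimInf.
Variables (R : realType) (u : (\bar R)^nat).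

Lemma limn_einf_sup_einfs : limn_einf u = ereal_sup (range (einfs u)).
Proof. by rewrite limn_einf_lim; apply/cvg_lim => //; exact: cvg_einfs_sup. Qed.

Lemma limn_einf_ge (c : \bar R) (n : nat) :
  (forall m, (n <= m)%N -> (c <= u m)%E) -> (c <= limn_einf u)%E.
Proof.
move=> cu; rewrite limn_einf_sup_einfs; apply: (@le_trans _ _ (einfs u n)).
  by apply: le_ereal_inf_tmp => _ [m /= nm <-]; exact: cu.
by apply: ereal_sup_ubound; exists n.
Qed.

Lemma limn_einf_gt (c : \bar R) : (c < limn_einf u)%E ->
  exists n, forall m, (n <= m)%N -> (c < u m)%E.
Proof.
rewrite limn_einf_sup_einfs => /ereal_sup_gt[_ [n _ <-] cn].
by exists n => m nm; apply: (lt_le_trans cn); apply: ereal_inf_lbound; exists m.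
Qed.

End LimInf.

Lemma polynomial_le_exponential (R : realType) (C p s : R) :
  0 < C -> 0 < p -> 0 < s ->
  exists m0 : nat, forall m : nat, (m0 <= m)%N ->
    C * m.+1%:R `^ p <= 2 `^ (s * m%:R).
Proof.
move=> C0 p0 s0; have ln2 : 0 < ln 2 :> R by rewrite ln_gt0 // ltr1n.
pose c := C `^ p^-1; have c0 : 0 <= c by exact: powR_ge0.
have d0 : 0 < s * ln 2 / p by rewrite divr_gt0 // mulr_gt0.
have [L0 L01 hL] := affine_le_expR c0 d0.
exists (Num.truncn L0).+1 => m hm.
have Lm : L0 <= m%:R.
  by apply: (le_trans (ltW (truncnS_gt _))); rewrite ler_nat.
have -> : C = c `^ p by rewrite /c -powRrM mulVf ?gt_eqF // powRr1 // ltW.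
rewrite -powRM //; have -> : 2 `^ (s * m%:R) = expR (s * ln 2 / p * m%:R) `^ p.
  rewrite /powR !gt_eqF ?expR_gt0 // expRK; congr expR.
  by field; rewrite gt_eqF.
rewrite ge0_ler_powR ?nnegrE ?(ltW p0) ?expR_ge0 ?mulr_ge0 //.
by rewrite -nat1r; exact: hL.
Qed.

Definition dim_term (R : realType) (rho : borel_probability R) (q : R)
    (m : nat) : R :=
  - log2 (dyadic_sum rho q m) / ((q - 1) * m%:R).

Lemma Lq_dimE (R : realType) (rho : borel_probability R) (q : R) :
  Lq_dim rho q = limn_einf (fun m => (dim_term rho q m)%:E).
Proof. by []. Qed.

Lemma log2_powR (R : realType) (x : R) : log2 (2 `^ x) = x.
Proof.
by rewrite /log2 ln_powR mulfK // gt_eqF // ln_gt0 // ltr1n.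
Qed.

Lemma log2_le (R : realType) (x y : R) : 0 < x -> x <= y -> log2 x <= log2 y.
Proof.
move=> x0 xy; have y0 : 0 < y by apply: lt_le_trans xy.
have ln2 : 0 < ln 2 :> R by rewrite ln_gt0 // ltr1n.
by rewrite /log2 ler_pM2r ?invr_gt0 // ler_ln.
Qed.

Lemma log2M (R : realType) (x y : R) :
  0 < x -> 0 < y -> log2 (x * y) = log2 x + log2 y.
Proof. by move=> x0 y0; rewrite /log2 lnM ?posrE // mulrDl. Qed.

(** The larger of the two summands of the bound decides which alternative holds;
    the loss [s] absorbs the polynomial factor. *)
Lemma dim_term_convolution_ge (R : realType) (q kappa d C : R)
    (rho mu : borel_probability R) :
  1 < q -> 0 < kappa -> 0 < C ->
  (forall m, 0 < dyadic_sum rho q m) -> (forall m, 0 < dyadic_sum mu q m) ->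
  (forall m : nat, dyadic_sum rho q m <= C * m.+1%:R `^ (q + 1) *
    (2 `^ (- (kappa * m%:R)) * dyadic_sum mu q m +
     2 `^ (- ((q - 1) * (1 - 2 * d) * m%:R)))) ->
  forall s : R, 0 < s -> exists n : nat, forall m : nat, (n <= m)%N ->
    dim_term mu q m + kappa / (q - 1) - s <= dim_term rho q m \/
    1 - 2 * d - s <= dim_term rho q m.
Proof.
move=> q1 kappa0 C0 rho0 mu0 bound s s0.
have q10 : 0 < q - 1 by rewrite subr_gt0.
have [n hn] : exists n : nat, forall m : nat, (n <= m)%N ->
    C * 2 * m.+1%:R `^ (q + 1) <= 2 `^ ((q - 1) * s * m%:R).
  apply: polynomial_le_exponential; rewrite ?mulr_gt0 //.
  by rewrite addr_gt0 // (lt_trans ltr01).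
exists n.+1 => m nm; have m0 : 0 < m%:R :> R by rewrite ltr0n (leq_trans _ nm).
have qm0 : 0 < (q - 1) * m%:R by rewrite mulr_gt0.
have bound2 X : 0 < X ->
  2 `^ (- (kappa * m%:R)) * dyadic_sum mu q m +
     2 `^ (- ((q - 1) * (1 - 2 * d) * m%:R)) <= 2 * X ->
  log2 (dyadic_sum rho q m) <= (q - 1) * s * m%:R + log2 X.
  move=> X0 hX; rewrite -[in leRHS](log2_powR ((q - 1) * s * m%:R)).
  rewrite -log2M ?powR_gt0 //; apply: log2_le => //.
  apply: (le_trans (bound m)).
  apply: (@le_trans _ _ (C * m.+1%:R `^ (q + 1) * (2 * X))).
    by rewrite ler_wpM2l // mulr_ge0 ?powR_ge0 // ltW.
  have -> : C * m.+1%:R `^ (q + 1) * (2 * X) = C * 2 * m.+1%:R `^ (q + 1) * X.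
    by ring.
  by rewrite ler_wpM2r ?(ltW X0) // hn // ltnW.
set X1 := 2 `^ (- (kappa * m%:R)) * dyadic_sum mu q m in bound2.
set X2 := 2 `^ (- ((q - 1) * (1 - 2 * d) * m%:R)) in bound2.
have X10 : 0 < X1 by rewrite mulr_gt0 ?powR_gt0.
have X20 : 0 < X2 by rewrite powR_gt0.
rewrite /dim_term; case: (leP X2 X1) => [X21|/ltW X12]; [left|right].
  have := bound2 X1 X10; rewrite log2M ?powR_gt0 // log2_powR => h.
  rewrite ler_pdivlMr //.
  have -> : (- log2 (dyadic_sum mu q m) / ((q - 1) * m%:R) + kappa / (q - 1) - s) *
    ((q - 1) * m%:R) = - log2 (dyadic_sum mu q m) + kappa * m%:R - (q - 1) * s * m%:R.
    by field; rewrite !gt_eqF.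
  by have := h _; lra.
have := bound2 X2 X20; rewrite log2_powR => h.
rewrite ler_pdivlMr //.
by have := h _; lra.
Qed.

Lemma dim_term_ge0 (R : realType) (rho : borel_probability R) (q : R) (m : nat) :
  1 < q -> compactly_supported rho -> 0 <= dim_term rho q m.
Proof.
move=> q1 /compact_support_bounded[B rhoB].
have ln2 : 0 < ln 2 :> R by rewrite ln_gt0 // ltr1n.
rewrite /dim_term divr_ge0 //; last by rewrite mulr_ge0 // subr_ge0 ltW.
rewrite oppr_ge0 /log2 pmulr_lle0 ?invr_gt0 // ln_le0 //.
exact: (dyadic_sum_le1 rhoB).
Qed.

Unset Implicit Arguments.

Theorem theorem1p1 (R : realType) (q N gamma eta : R)
    (hq : 1 < q) (hN : 1 < N) (hgamma : 0 < gamma) (heta : 0 < eta) :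
  exists2 eps : R, 0 < eps &
    forall nu : borel_probability R,
      compactly_supported nu -> uniformly_perfect N gamma nu ->
      (* nu is not a Dirac mass *)
      (forall a : R, spt nu <> [set a]) ->
      forall mu : borel_probability R,
        compactly_supported mu ->
        (Lq_dim mu q <= (1 - eta)%:E)%E ->
        (Lq_dim mu q + eps%:E < Lq_dim (convolution mu nu) q)%E.
Proof.
have q0 : 0 < q by apply: lt_trans hq.
have q10 : 0 < q - 1 by rewrite subr_gt0.
(* Truncation at 1 keeps the exponent [d = e / 4] below 1. *)
pose e := Num.min eta 1.
have e0 : 0 < e by rewrite lt_min heta ltr01.
have e1 : e <= 1 by rewrite ge_min lexx orbT.
have e_eta : e <= eta by rewrite ge_min lexx.
have d0 : 0 < e / 4 by rewrite divr_gt0.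
have d1 : e / 4 < 1 by lra.
have [kappa kappa0 improve] := dyadic_sum_improvement N gamma hq d0 d1.
pose k := Num.min (kappa / (q - 1)) (e / 2).
have k0 : 0 < k by rewrite lt_min !divr_gt0.
have k_kappa : k <= kappa / (q - 1) by rewrite ge_min lexx.
have k_e : k <= e / 2 by rewrite ge_min lexx orbT.
exists (k / 4); first by rewrite divr_gt0.
move=> nu nu_cpt perf nDirac mu mu_cpt dim_mu.
have [C C0 bound] := improve nu nu_cpt perf nDirac mu mu_cpt.
have [B muB nuB] := common_support_bound mu_cpt nu_cpt.
have mu_pos m : 0 < dyadic_sum mu q m by exact: (dyadic_sum_gt0 muB).
have conv_pos m : 0 < dyadic_sum (convolution mu nu) q m.
  exact: (dyadic_sum_gt0 (convolution_null muB nuB)).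
have dim_mu0 : (0%:E <= Lq_dim mu q)%E.
  rewrite Lq_dimE; apply: (limn_einf_ge (n := 0%N)) => m _.
  by rewrite lee_fin; exact: dim_term_ge0.
have [D DE] : exists D, Lq_dim mu q = D%:E.
  exists (fine (Lq_dim mu q)); rewrite fineK // ge0_fin_numE //.
  exact: le_lt_trans dim_mu (ltry _).
rewrite DE lee_fin in dim_mu; rewrite DE -EFinD.
have s0 : 0 < k / 8 by rewrite divr_gt0.
have [n1 conv_ge] := dim_term_convolution_ge hq kappa0 C0 conv_pos mu_pos bound s0.
have [n2 mu_ge] : exists n, forall m, (n <= m)%N ->
    ((D - k / 8)%:E < (dim_term mu q m)%:E)%E.
  by apply: limn_einf_gt; rewrite -Lq_dimE DE lte_fin; lra.
apply: (@lt_le_trans _ _ (D + k / 2)%:E); first by rewrite lte_fin; lra.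
rewrite Lq_dimE; apply: (limn_einf_ge (n := maxn n1 n2)) => m.
rewrite geq_max => /andP[mn1 mn2]; have := mu_ge m mn2; rewrite lte_fin => hmu.
rewrite lee_fin; have [h|h] := conv_ge m mn1; lra.
Qed.
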